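(* The adaptive priority algorithm with advice $\mathrm{PriorityVC}$ (defined in the context) solves Minimum Vertex Cover on triangle-free graphs with maximum degree $3$ optimally, i.e., on every such input graph the set of accepted vertices is a minimum vertex cover. It is an algorithm in both the decision-based and the oblivious priority function models, and it uses at most $(7/22)\,n$ bits of advice, where $n$ is the number of vertices of the input graph.
   Context: **Problem.** Minimum Vertex Cover: given a finite simple undirected graph $G=(V,E)$, find a minimum-size $S\subseteq V$ such that every edge has an endpoint in $S$. ''Maximum degree $3$'' means all degrees are at most $3$. Vertex arrival, vertex adjacency model: an input item is a pair $(v,N(v))$, a vertex name together with the list of all its neighbors (including those not yet received). The decision for $v$ is ''accept'' (put $v$ in the cover) or ''reject''. **Adaptive priority algorithm with advice.** There is a universe $\mathcal U$ of input items; an input is a finite multiset $X$ of items. An oracle that knows the algorithm and all of $X$ (and can simulate the algorithm, including tie-breaking) writes an infinite binary advice tape. The (deterministic) algorithm may first read some bits of the tape, sequentially. Then, in iteration $i=1,2,\dots$ until $X$ is empty, it specifies a priority function $P_i:\mathcal U\to\mathbb R$, receives an item $x_i$ of the remaining input $X$ maximizing $P_i$ (ties broken adversarially), which is removed from $X$, reads zero or more further advice bits, and makes an irrevocable decision $d_i$. The decision and the number of bits read are functions of the items received, the advice read and the decisions made so far. The number of advice bits used is the number of bits read. Decision-based priority function model: $P_i$ depends only on $x_1,\dots,x_{i-1},d_1,\dots,d_{i-1}$. Oblivious priority function model: $P_i$ may depend on $x_1,\dots,x_{i-1}$ and on the advice read so far, but it must give the same priority to all input items that are indistinguishable when ignoring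 names not present in the items already received (e.g., for unweighted graphs, vertices of the same degree such that neither they nor their neighbors have been seen yet get the same priority). **Terminology (at a given time step).** A vertex is *processed* once a decision has been made for it, otherwise *unprocessed*. The *current neighborhood* of $v$ is $N(v)$ minus the processed vertices, and its *current degree* is the size of this set. - *aa-vertex*: processed vertex that received advice to be accepted; *ar-vertex*: processed vertex that received advice to be rejected; *a-vertex*: an aa- or ar-vertex. - *contributing vertex*: an aa-vertex that has two rejected neighbors and one unprocessed neighbor. - *c-neighbor*: an unprocessed vertex that is a neighbor of a contributing vertex. - *bad-vertex*: a vertex that requires advice and all of whose neighbors are c-neighbors of other vertices at the time this vertex is processed. - *a-sibling*: a neighbor of an aa-vertex $v$ such that $v$ has another neighbor that has been accepted. **Algorithm PriorityVC.** While there are unprocessed vertices, use the priority function with the following classes, from highest to lowest priority (remaining ties are broken arbitrarily, even by an adaptive adversary), to receive the next vertex $v$: - P1: vertices with a rejected neighbor; highest priority to those whose neighbor was most recently rejected. - P2: vertices of current degree $0$. - P3: vertices of current degree $1$; highest priority to those with a most recently processed neighbor; among those, highest priority to those that had two neighbors that became aa-vertices. - P4: vertices of current degree $2$ that had a third neighbor in common with a previously rejected bad-vertex. - P5: a-siblings. - P6: vertices of current degree $3$ with $2$ or $3$ neighbors in common with a single aa-vertex that was not a bad-vertex when it received advice. - P7: vertices of current degree $3$ that share neighbors with a-vertices. - P8: other vertices of current degree $3$. - P9: vertices of current degree $2$. If $v$ has priority P1 or P6, accept $v$. If $v$ has priority P2, P3, P4, P5 or P9, reject $v$. If $v$ has priority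 P7 or P8, read one bit of advice, which says accept or reject, and follow it. **Oracle.** A decision is *correct* if the partial solution after the decision can be extended to a minimum vertex cover of the input graph. When advice is requested for $v$: if there is a unique correct decision, the oracle gives it; if both decisions are correct and $v$ is a bad-vertex, the oracle says accept; if both are correct and $v$ is not a bad-vertex, the oracle says reject. *)

(* Defs.v *)
From HB Require Import structures.
From mathcomp Require Import all_boot all_order all_algebra.
From mathcomp Require Import finmap reals.

Set Implicit Arguments.
Unset Strict Implicit.
Unset Printing Implicit Defensive.

Import Order.TTheory GRing.Theory Num.Theory.

Local Open Scope fset_scope.

(** * Graphs and vertex covers *)

Record graph := Graph {
  vertices : {fset nat};
  adj : rel nat;
  adj_sym : symmetric adj;
  adj_irr : irreflexive adj;
  adj_vertices : forall u v, adj u v -> u \in vertices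
}.

Definition neighbors (G : graph) (v : nat) : {fset nat} :=
  [fset u in vertices G | adj G v u].

Definition triangle_free (G : graph) : Prop :=
  forall u v w, ~~ [&& adj G u v, adj G v w & adj G u w].

Definition max_degree_le (d : nat) (G : graph) : Prop :=
  forall v, v \in vertices G -> (#|` neighbors G v| <= d)%N.

Definition vertex_cover (G : graph) (S : {fset nat}) : Prop :=
  S `<=` vertices G /\ forall u v, adj G u v -> (u \in S) || (v \in S).

Definition minimum_vertex_cover (G : graph) (S : {fset nat}) : Prop :=
  vertex_cover G S /\ forall T, vertex_cover G T -> (#|` S| <= #|` T|)%N.

(** * Adaptive priority algorithms with advice *)

(* An input item [(v, N)]: a vertex name and the set of the names of all the
   neighbors of that vertex. *)
Definition item := (nat * {fset nat})%type.

Definition input (G : graph) : seq item :=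
  [seq (v, neighbors G v) | v <- enum_fset (vertices G)].

(* The items received so far together with the decisions made for them
   ([true] = accept), MOST RECENT FIRST. *)
Definition history := seq (item * bool).

Definition items_of (h : history) : seq item := [seq p.1 | p <- h].

(* A procedure that reads zero or more bits of the tape, one after the other
   (each reading may depend on the bits read before), and returns a value. *)
Inductive reading (D : Type) : Type :=
  | Done of D
  | Read of (bool -> reading D).

(* Runs a reading procedure on a tape from position [k]; returns its value and
   the new position. *)
Fixpoint consult (D : Type) (r : reading D) (t : nat -> bool) (k : nat)
    : D * nat :=
  match r with
  | Done d => (d, k)
  | Read f => consult (f (t k)) t k.+1
  end.

(* The [seq bool] arguments are the advice bits read so far, in tape order; the
   [item] argument of [decision] is the item just received. *)
Record algorithm (R : realType) := Algorithm {
  preamble : reading unit;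
  priority : history -> seq bool -> item -> R;
  decision : history -> seq bool -> item -> reading bool
}.

(* The history, and the number of advice bits read, once the items [xs] (most
   recent first) have been received, with advice tape [t]. *)
Fixpoint replay (R : realType) (A : algorithm R) (t : nat -> bool)
    (xs : seq item) : history * nat :=
  match xs with
  | [::] => ([::], (consult (preamble A) t 0).2)
  | x :: xs' =>
      let: (h, k) := replay A t xs' in
      let: (d, k') := consult (decision A h (mkseq t k) x) t k in
      ((x, d) :: h, k')
  end.

(* Tie-breaking by an adaptive adversary: given the history, the advice read so
   far and the remaining items of maximal priority, it chooses one of them. *)
Definition tie_breaker := history -> seq bool -> seq item -> item.

Definition valid_tie_breaker (tb : tie_breaker) : Prop :=
  forall h a s, s != [::] -> tb h a s \in s.

Definition top_items (R : realType) (A : algorithm R) (h : history)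
    (a : seq bool) (rest : seq item) : seq item :=
  [seq y <- rest | all (fun z => (priority A h a z <= priority A h a y)%R) rest].

Definition remaining (X xs : seq item) : seq item :=
  foldr (fun x s => rem x s) X xs.

Definition next_item (R : realType) (A : algorithm R) (tb : tie_breaker)
    (t : nat -> bool) (X xs : seq item) : item :=
  let: (h, k) := replay A t xs in
  let a := mkseq t k in
  tb h a (top_items A h a (remaining X xs)).

(* The items received in the first [i] iterations on input [X], most recent
   first. *)
Fixpoint received (R : realType) (A : algorithm R) (tb : tie_breaker)
    (t : nat -> bool) (X : seq item) (i : nat) : seq item :=
  match i with
  | 0 => [::]
  | i'.+1 =>
      let xs := received A tb t X i' in
      next_item A tb t X xs :: xs
  end.

Definition execute (R : realType) (A : algorithm R) (tb : tie_breaker)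
    (t : nat -> bool) (X : seq item) : history * nat :=
  replay A t (received A tb t X (size X)).

Definition accepted_vertices (R : realType) (A : algorithm R)
    (tb : tie_breaker) (t : nat -> bool) (X : seq item) : {fset nat} :=
  [fset v in [seq p.1.1 | p <- (execute A tb t X).1 & p.2]].

Definition advice_bits_used (R : realType) (A : algorithm R)
    (tb : tie_breaker) (t : nat -> bool) (X : seq item) : nat :=
  (execute A tb t X).2.

(** * Decision-based and oblivious priority functions *)

Definition decision_based (R : realType) (A : algorithm R) : Prop :=
  forall h a a' x, priority A h a x = priority A h a' x.

Definition names_in (xs : seq item) : {fset nat} :=
  [fset u in flatten [seq x.1 :: enum_fset x.2 | x <- xs]].

(* What is left of an item when the names outside [S] are ignored: those names
   are erased, but an erased neighbor still counts in the degree. *)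
Definition anonymize (S : {fset nat}) (x : item)
    : option nat * {fset nat} * nat :=
  (if x.1 \in S then Some x.1 else None, x.2 `&` S, #|` x.2|).

(* The decisions are themselves determined by the items received and the advice
   read, so "the priority function depends only on the items received and the
   advice read" is a condition on the histories that can actually arise. *)
Definition oblivious (R : realType) (A : algorithm R) : Prop :=
  exists Q : seq item -> seq bool -> item -> R,
    (forall t xs x, let: (h, k) := replay A t xs in
       priority A h (mkseq t k) x = Q xs (mkseq t k) x) /\
    (forall xs a x y,
       anonymize (names_in xs) x = anonymize (names_in xs) y ->
       Q xs a x = Q xs a y).

(** * PriorityVC *)

(* A processed vertex.  [ad] : it received advice; [bad] : it was a bad-vertex
   when it was processed. *)
Record entry := Entry { it : item; acc : bool; ad : bool; bad : bool }.

Definition vname (e : entry) : nat := (it e).1.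
Definition nbh (e : entry) : {fset nat} := (it e).2.

Definition aa (e : entry) : bool := ad e && acc e.

(* Processed vertices, MOST RECENT FIRST. *)
Definition log := seq entry.

Section State.

Variable l : log.

Definition processed : seq nat := [seq vname e | e <- l].
Definition accepted : seq nat := [seq vname e | e <- l & acc e].
Definition rejected : seq nat := [seq vname e | e <- l & ~~ acc e].

Definition current_neighborhood (x : item) : {fset nat} :=
  [fset u in x.2 | u \notin processed].

Definition current_degree (x : item) : nat := #|` current_neighborhood x|.

Definition contributing (e : entry) : bool :=
  [&& aa e,
      #|` [fset u in nbh e | u \in rejected]| == 2%N
    & #|` current_neighborhood (it e)| == 1%N].

Definition c_neighbor (u : nat) : bool :=
  (u \notin processed) && has (fun e => contributing e && (u \in nbh e)) l.

Definition processed_neighbor (x : item) (e : entry) : bool := vname e \in x.2.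

Definition rejected_neighbor (x : item) (e : entry) : bool :=
  processed_neighbor x e && ~~ acc e.

Definition meets_rejected_bad (e : entry) : bool :=
  has (fun b => [&& bad b, ~~ acc b & vname e \in nbh b]) l.

Definition a_sibling (x : item) : bool :=
  has (fun e => [&& aa e, processed_neighbor x e
                  & has (fun u => (u != x.1) && (u \in accepted)) (nbh e)]) l.

Definition common (x : item) (e : entry) : nat := #|` x.2 `&` nbh e|.

(* The number i of the class P_i, or 10 if there is none (which cannot happen
   if all degrees are at most 3). *)
Definition vclass (x : item) : nat :=
  let d := current_degree x in
  if has (rejected_neighbor x) l then 1
  else if d == 0%N then 2
  else if d == 1%N then 3
  else if (d == 2%N)
          && has (fun e => processed_neighbor x e && meets_rejected_bad e) l
       then 4
  else if a_sibling x then 5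
  else if (d == 3%N)
          && has (fun e => [&& aa e, ~~ bad e & (2 <= common x e)%N]) l then 6
  else if (d == 3%N) && has (fun e => ad e && (1 <= common x e)%N) l then 7
  else if d == 3%N then 8
  else if d == 2%N then 9
  else 10.

(* The iteration (counted from 1) in which the most recently processed vertex
   satisfying [p] was processed; 0 if there is none. *)
Definition last_time (p : pred entry) : nat := (size l - find p l)%N.

(* Secondary criterion, used in the classes P1 and P3. *)
Definition recency (x : item) : nat :=
  if vclass x == 1%N then last_time (rejected_neighbor x)
  else if vclass x == 3%N then last_time (processed_neighbor x)
  else 0.

(* Tertiary criterion, used in the class P3. *)
Definition two_aa (x : item) : bool :=
  (vclass x == 3%N)
  && (2 <= count (fun e => processed_neighbor x e && aa e) l)%N.

(* Encodes the lexicographic order on (vclass reversed, recency, two_aa): here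
   [recency x <= size l], so [recency x * 2 + two_aa x < (size l).+1 * 2]. *)
Definition rank (x : item) : nat :=
  ((10 - vclass x) * ((size l).+1 * 2) + recency x * 2 + two_aa x)%N.

Definition requests_advice (x : item) : bool :=
  (vclass x == 7%N) || (vclass x == 8%N).

Definition bad_vertex (x : item) : bool :=
  requests_advice x && all c_neighbor (enum_fset x.2).

End State.

(* Whether a vertex received advice, or was bad, refers to the state in which
   it was processed, i.e. to the part of the history that precedes it. *)
Fixpoint log_of (h : history) : log :=
  match h with
  | [::] => [::]
  | (x, d) :: h' =>
      let l := log_of h' in
      Entry x d (requests_advice l x) (bad_vertex l x) :: l
  end.

(* In class 10 the decision is immaterial. *)
Definition PriorityVC (R : realType) : algorithm R := {|
  preamble := Done tt;
  priority := fun h _ x => ((rank (log_of h) x)%:R)%R;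
  decision := fun h _ x =>
    let l := log_of h in
    if requests_advice l x then Read (@Done bool)
    else Done ((vclass l x == 1%N) || (vclass l x == 6%N))
|}.

(** * The oracle *)

(* The partial solution [h] extends to a minimum vertex cover of [G]. *)
Definition extendable (G : graph) (h : history) : Prop :=
  exists S, minimum_vertex_cover G S /\
    forall p, p \in h -> (p.1.1 \in S) = p.2.

Definition correct (G : graph) (h : history) (x : item) (d : bool) : Prop :=
  extendable G ((x, d) :: h).

(* [b] is the advice for the vertex [x]; it is unconstrained if no decision is
   correct. *)
Definition oracle_advice (G : graph) (h : history) (x : item) (b : bool)
    : Prop :=
  (forall d, correct G h x d -> ~ correct G h x (~~ d) -> b = d) /\
  (correct G h x true -> correct G h x false ->
     b = bad_vertex (log_of h) x).

(* [t] is a tape written by the oracle for the run of PriorityVC on [G] under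
   the tie-breaking [tb]: every bit read in this run is the oracle's advice. *)
Definition oracle_tape (R : realType) (G : graph) (tb : tie_breaker)
    (t : nat -> bool) : Prop :=
  forall i, (i < size (input G))%N ->
    let xs := received (PriorityVC R) tb t (input G) i in
    let x := next_item (PriorityVC R) tb t (input G) xs in
    let: (h, k) := replay (PriorityVC R) t xs in
    requests_advice (log_of h) x -> oracle_advice G h x (t k).

(* Main.v *)
(* The advice bound is a potential argument that works for every advice tape.
   Call an unprocessed vertex dead if the classes P1-P5 are bound to process it
   before the next request for advice.  A processed or dead vertex has weight 7;
   any other vertex has weight 3 minus its number of live neighbors, plus 2 if it
   has an aa-neighbor, plus 2 if it is marked (see below).  Weights never
   decrease, never exceed 7, and finally add up to 7n.  A request for advice
   costs 22, and raises the total weight by 22 up to a slack of 2, 4 or 6.  A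
   slack exists only while there is an active vertex: live, unmarked, with an
   aa-neighbor.  Once no vertex of degree 3 is next to an active vertex, i.e. in
   the classes P8 and P9, all active vertices get marked, which repays the
   slack.

   The oracle matters only for optimality.  Decisions without advice are
   justified by exchanging one vertex of a minimum cover for another, except in
   P9, where the rest of the graph is 2-regular: there either some optimal
   extension avoids the vertex, or all of them alternate around its component,
   and one can flip the cover on that component. *)

(* Treating a vertex as finished as soon as its fate is sealed spares following the cascades of
   P1-P5.

   The constant 22 is the gain of a rejection with three active neighbors: 7 for the vertex, and for
   each neighbor 4 of missing weight and 1 at its other neighbor. The obstacle is acceptance, where
   a neighbor of current degree 3 stays alive and gains only 3: with three such neighbors the gain
   is 7 + 9 = 16, which leaves a slack of 6. A number alone cannot carry this debt, so [bounded]
   couples each slack with a shape of active vertices that guarantees a surplus at the next request.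
   Every requested rejection brings the slack to 0. Requested acceptances bring 6 to at most 4, and
   4 to at most 2, sometimes only after one further leaf step; from 2 it never grows, since an
   acceptance that fails to repay it creates a new active vertex. Many of these budgets are met with
   equality. Triangle-freeness and P6 keep them valid: neighbors of a requesting vertex are not
   adjacent, and it shares at most one unprocessed neighbor with any aa-vertex. *)
From HB Require Import structures.
Require Import Defs.
From mathcomp Require Import all_boot all_order all_algebra.
From mathcomp Require Import finmap boolp reals zify lra.

Set Implicit Arguments.
Unset Strict Implicit.
Unset Printing Implicit Defensive.

Local Open Scope fset_scope.
Local Open Scope nat_scope.

(* An equality on entries makes [\in] available for logs. *)
Definition entry_code (e : entry) := (it e, acc e, ad e, bad e).
Definition entry_decode (p : item * bool * bool * bool) :=
  let: (x, a, r, b) := p in Entry x a r b.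
Lemma entry_codeK : cancel entry_code entry_decode. Proof. by case. Qed.
HB.instance Definition _ := Equality.copy entry (can_type entry_codeK).

(** * Counting in sequences, and abstract runs of the algorithm *)

Lemma card_fset_sep (A : {fset nat}) (p : pred nat) :
  #|` [fset u in A | p u]| = count p A.
Proof.
rewrite -size_filter; apply: perm_size; apply: uniq_perm.
- exact: fset_uniq.
- exact: filter_uniq (fset_uniq _).
- by move=> u; rewrite mem_filter !inE andbC.
Qed.

Lemma count_notin_cons (x : nat) (s P : seq nat) : uniq s ->
  count [pred z | z \notin x :: P] s + ((x \in s) && (x \notin P))
    = count [pred z | z \notin P] s.
Proof.
elim: s => //= y s IHs /andP[ys us]; rewrite -IHs // !inE !negb_or eq_sym.
case: (eqVneq x y) => [->|_] /=; last by rewrite addnA.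
by rewrite (negPf ys) /=; lia.
Qed.

Lemma count_sub (T : eqType) (p q : pred T) (s : seq T) :
  {in s, forall z, p z -> q z} -> count p s <= count q s.
Proof.
move=> pq; rewrite -!size_filter; have -> : filter p s = filter p (filter q s).
  rewrite -filter_predI; apply: eq_in_filter => z zs /=.
  by case pz: (p z) => //=; rewrite pq.
by rewrite size_filter; apply: leq_trans (count_size _ _) _.
Qed.

Definition vitem (G : graph) (v : nat) : item := (v, neighbors G v).

Definition top (G : graph) (l : log) (v : nat) := forall u,
  u \in vertices G -> u \notin processed l ->
  vclass l (vitem G v) <= vclass l (vitem G u).

(* The logs of PriorityVC under arbitrary advice and tie-breaking; of the
   priority function, only the class of a vertex is kept. *)
Inductive run (G : graph) : log -> Prop :=
| run_nil : run G [::]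
| run_cons l v a : run G l -> v \in vertices G -> v \notin processed l ->
    (forall u, u \in vertices G -> u \notin processed l ->
       vclass l (vitem G v) <= vclass l (vitem G u)) ->
    (~~ requests_advice l (vitem G v) ->
       a = (vclass l (vitem G v) == 1) || (vclass l (vitem G v) == 6)) ->
    run G (Entry (vitem G v) a (requests_advice l (vitem G v))
                 (bad_vertex l (vitem G v)) :: l).

Lemma count2P (T : eqType) (p : pred T) (s : seq T) : uniq s ->
  2 <= count p s -> exists x y, [/\ x != y, x \in s, y \in s, p x & p y].
Proof.
move=> us; rewrite -size_filter; case E: (filter p s) => [|x [|y r]] // _.
have /andP[xy _] : (x \notin y :: r) && uniq (y :: r).
  by have := filter_uniq p us; rewrite E.
have mf z : z \in [:: x, y & r] -> (z \in s) && p z.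
  by rewrite -E mem_filter andbC.
exists x, y; move: xy; rewrite inE negb_or => /andP[xy _].
have /andP[? ?] := mf x (mem_head _ _).
by have /andP[? ?] : (y \in s) && p y by apply: mf; rewrite !inE eqxx orbT.
Qed.

Lemma count1P (T : eqType) (p : pred T) (s : seq T) :
  1 <= count p s -> exists2 x, x \in s & p x.
Proof. by rewrite -has_count => /hasP. Qed.

Lemma sum_indicator (T : eqType) (x : T) (s : seq T) (f : T -> nat) : uniq s ->
  \sum_(y <- s) (y == x) * f y = (x \in s) * f x.
Proof.
move=> us; case: (boolP (x \in s)) => xs; last first.
  rewrite big_seq big1 ?mul0n // => y ys; case: eqP => // E.
  by rewrite -E ys in xs.
rewrite (bigD1_seq x) //= eqxx !mul1n big1 ?addn0 // => y /negPf->.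
by rewrite mul0n.
Qed.

Lemma count_ge2 (T : eqType) (p : pred T) (s : seq T) x y : uniq s -> x != y ->
  x \in s -> y \in s -> p x -> p y -> 2 <= count p s.
Proof.
move=> us xy xs ys px py; rewrite -size_filter.
have -> : 2 = size [:: x; y] by [].
apply: uniq_leq_size; first by rewrite /= inE xy.
by move=> z; rewrite !inE mem_filter => /orP[]/eqP->; rewrite ?px ?py.
Qed.

Lemma processed_split (l : log) u : u \in processed l ->
  (u \in accepted l) || (u \in rejected l).
Proof.
case/mapP=> e el ->; case ae: (acc e); apply/orP; [left|right];
  by apply: map_f; rewrite mem_filter ae el.
Qed.

Lemma count_mem_sym (T : eqType) (s t : seq T) : uniq s -> uniq t ->
  count [pred x | x \in s] t = count [pred x | x \in t] s.
Proof.
move=> us ut; rewrite -!size_filter; apply: perm_size; apply: uniq_perm.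
- by rewrite filter_uniq.
- by rewrite filter_uniq.
- by move=> z; rewrite !mem_filter andbC.
Qed.

Lemma third_mem (T : eqType) (s : seq T) x y : uniq s -> size s <= 3 ->
  x \in s -> y \in s -> x != y ->
  exists z, {in s, forall w, [|| w == x, w == y | w == z]}.
Proof.
move=> us s3 xs ys xy.
have yr : y \in rem x s by rewrite mem_rem_uniq // inE eq_sym xy.
have ur : uniq (rem x s) by rewrite rem_uniq.
have : size (rem y (rem x s)) <= 1.
  by rewrite (size_rem yr) (size_rem xs); move: s3; clear; lia.
case E: (rem y (rem x s)) => [|z [|]] // _; [exists x|exists z].
all: move=> w ws; case: eqVneq => //= wx; case: eqVneq => //= wy.
all: have : w \in rem y (rem x s) by rewrite (mem_rem_uniq y ur) inE wy /=
  (mem_rem_uniq x us) inE wx.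
all: by rewrite E ?in_nil // mem_seq1.
Qed.

(** Stated on histories because the oracle judges partial solutions; [log_of] turns such a run into
    a [run]. *)
Inductive oracle_run (G : graph) : history -> Prop :=
| oracle_run_nil : oracle_run G [::]
| oracle_run_cons h v a : oracle_run G h -> v \in vertices G ->
    v \notin processed (log_of h) -> top G (log_of h) v ->
    (~~ requests_advice (log_of h) (vitem G v) ->
       a = (vclass (log_of h) (vitem G v) == 1) || (vclass (log_of h) (vitem G
         v) == 6)) ->
    (requests_advice (log_of h) (vitem G v) -> oracle_advice G h (vitem G v) a)
      ->
    oracle_run G ((vitem G v, a) :: h).

(** * The potential *)

Section Graph.

Variable G : graph.
Hypothesis deg3 : max_degree_le 3 G.
Hypothesis tf : triangle_free G.

Local Notation N := (neighbors G).
Local Notation V := (vertices G).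

Lemma nbrE u v : (u \in N v) = adj G v u.
Proof.
rewrite !inE /=; case E: (adj G v u); last by rewrite andbF.
by rewrite andbT; apply: (@adj_vertices G u v); rewrite adj_sym.
Qed.

Lemma nbrC u v : (u \in N v) = (v \in N u).
Proof. by rewrite !nbrE adj_sym. Qed.

Lemma nbrxx u : (u \in N u) = false.
Proof. by rewrite nbrE adj_irr. Qed.

Lemma nbrV u v : u \in N v -> u \in V.
Proof. by rewrite !inE => /andP[]. Qed.

Lemma size_nbr u : u \in V -> size (N u) <= 3.
Proof. by move=> /deg3. Qed.

Lemma uniq_nbr u : uniq (N u). Proof. exact: fset_uniq. Qed.

Definition deg (l : log) (u : nat) : nat :=
  count [pred z | z \notin processed l] (N u).

Lemma current_degreeE l u : current_degree l (vitem G u) = deg l u.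
Proof. by rewrite /current_degree /current_neighborhood card_fset_sep. Qed.

Definition forced (l : log) (u : nat) : bool :=
  has (rejected_neighbor (vitem G u)) l.

Definition aanbr (l : log) (u : nat) : bool :=
  has (fun e => aa e && (u \in nbh e)) l.

(* Anticipates P5: a forced vertex is going to be accepted. *)
Definition doomed_sibling (l : log) (u : nat) : bool :=
  has (fun e => [&& aa e, u \in nbh e &
    has (fun y => (y != u) &&
       ((y \in accepted l) || (y \notin processed l) && forced l y)) (nbh e)])
         l.

(* Anticipates P4: once the forced neighbors of the bad-vertex are processed,
   [u] has current degree at most 2. *)
Definition near_rejected_bad (l : log) (u : nat) : bool :=
  has (fun b => [&& bad b, ~~ acc b & has (fun y => y \in N u) (nbh b)]) l.

(* The leaf [w] is going to be rejected, unless [u] becomes a leaf itself. *)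
Definition near_leaf (l : log) (u : nat) : bool :=
  has (fun w => [&& w \notin processed l, ~~ forced l w & deg l w <= 1]) (N u).

Definition dead (l : log) (u : nat) : bool :=
  [|| u \in processed l, forced l u, deg l u <= 1, doomed_sibling l u,
      near_rejected_bad l u | near_leaf l u].

Definition live (l : log) (u : nat) : nat :=
  count [pred z | ~~ dead l z] (N u).

Definition phi (l : log) (M : pred nat) (u : nat) : nat :=
  if dead l u then 7 else 3 - live l u + (aanbr l u).*2 + (M u).*2.

Definition Phi l M := \sum_(u <- V) phi l M u.

Definition act l (M : pred nat) u := [&& ~~ dead l u, aanbr l u & ~~ M u].

Lemma run_wf l : run G l -> forall e : entry, e \in l ->
  it e = vitem G (vname e) /\ vname e \in V.
Proof.
elim=> // {}l v a _ IH vV _ _ _ e; rewrite inE => /orP[/eqP->|/IH//].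
by rewrite /vname /=.
Qed.

Lemma nbhE l e : run G l -> e \in l -> nbh e = N (vname e).
Proof. by move=> /run_wf wf /wf[E _]; rewrite /nbh E. Qed.

Lemma deg_le3 l u : u \in V -> deg l u <= 3.
Proof. by move=> uV; apply: leq_trans (count_size _ _) (size_nbr uV). Qed.

Lemma deg3P l u : u \in V -> deg l u = 3 ->
  size (N u) = 3 /\ {in N u, forall z, z \notin processed l}.
Proof.
move=> uV d3; have s3 : size (N u) = 3.
  by apply/eqP; rewrite eqn_leq size_nbr //= -d3 count_size.
split=> // z zN; have : all [pred z | z \notin processed l] (N u).
  by rewrite all_count -/(deg l u) d3 s3.
by move=> /allP/(_ z zN).
Qed.

Lemma deg_cons e l u : vname e \notin processed l ->
  deg (e :: l) u + (vname e \in N u) = deg l u.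
Proof.
move=> vP; rewrite /deg -[RHS](@count_notin_cons (vname e)) ?uniq_nbr //.
by rewrite vP andbT.
Qed.

Lemma forcedP l u : reflect (exists2 e, e \in l & (vname e \in N u) && ~~ acc e)
                            (forced l u).
Proof. exact: hasP. Qed.

Lemma forced_cons e l u :
  forced (e :: l) u = (vname e \in N u) && ~~ acc e || forced l u.
Proof. by []. Qed.

Lemma aanbr_cons e l u : aanbr (e :: l) u = aa e && (u \in nbh e) || aanbr l u.
Proof. by []. Qed.

Lemma aanbr_deg l u : run G l -> u \in V -> aanbr l u -> deg l u <= 2.
Proof.
move=> r uV /hasP[e el /andP[_]]; rewrite (nbhE r el) nbrC => eu.
rewrite -ltnS; apply: leq_trans (size_nbr uV); rewrite ltn_neqAle count_size
  andbT.
rewrite -all_count; apply/negP => /allP/(_ _ eu) /=.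
by rewrite map_f.
Qed.

Variant vclass_spec l u : nat -> Prop :=
| VC1 of forced l u : vclass_spec l u 1
| VC2 of ~~ forced l u & deg l u = 0 : vclass_spec l u 2
| VC3 of ~~ forced l u & deg l u = 1 : vclass_spec l u 3
| VC4 of ~~ forced l u & deg l u = 2 &
   has (fun e => processed_neighbor (vitem G u) e && meets_rejected_bad l e) l
   : vclass_spec l u 4
| VC5 of ~~ forced l u & 2 <= deg l u & a_sibling l (vitem G u)
   : vclass_spec l u 5
| VC6 of ~~ forced l u & deg l u = 3 &
   has (fun e => [&& aa e, ~~ bad e & 2 <= common (vitem G u) e]) l
   : vclass_spec l u 6
| VC7 of ~~ forced l u & deg l u = 3 &
   ~~ has (fun e => [&& aa e, ~~ bad e & 2 <= common (vitem G u) e]) l &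
   has (fun e => ad e && (1 <= common (vitem G u) e)) l
   : vclass_spec l u 7
| VC8 of ~~ forced l u & deg l u = 3 &
   ~~ has (fun e => ad e && (1 <= common (vitem G u) e)) l
   : vclass_spec l u 8
| VC9 of ~~ forced l u & deg l u = 2 : vclass_spec l u 9.

Lemma vclassP l u : u \in V -> vclass_spec l u (vclass l (vitem G u)).
Proof.
move=> uV; have := deg_le3 l uV; rewrite /vclass current_degreeE -/(forced l u).
case: (boolP (forced l u)) => [|nf d3]; first by constructor.
case: eqP => [|/eqP d0]; first by constructor.
case: eqP => [|/eqP d1]; first by constructor.
have d2 : 2 <= deg l u by lia.
case: ifP => [/andP[/eqP ? ?]|n4]; first by constructor.
case: ifP => [?|n5]; first by constructor.
case: ifP => [/andP[/eqP ? ?]|n6]; first by constructor.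
case: ifP => [/andP[/eqP e3 ?]|n7]; first by constructor=> //; move: n6;
  rewrite e3 => /negbT.
case: eqP => [e3|n3]; first by constructor=> //; move: n7; rewrite e3 => /negbT.
case: eqP => [e2|n2]; first by constructor.
lia.
Qed.

Lemma forced_class l u : forced l u -> vclass l (vitem G u) = 1.
Proof. by rewrite /vclass -/(forced l u) => ->. Qed.

Lemma leaf_class l u : deg l u <= 1 -> vclass l (vitem G u) <= 3.
Proof.
rewrite /vclass current_degreeE; case: has => //.
by case: (deg l u) => [|[|]].
Qed.

Lemma a_sibling_class l u : a_sibling l (vitem G u) ->
  vclass l (vitem G u) <= 5.
Proof. by rewrite /vclass => ->; do !case: ifP. Qed.

Lemma vclass4 l u : deg l u = 2 ->
   has (fun e => processed_neighbor (vitem G u) e && meets_rejected_bad l e) l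
     ->
  vclass l (vitem G u) <= 4.
Proof. by rewrite /vclass current_degreeE => -> -> /=; case: ifP. Qed.

(* When the received vertex has class at least 6, nothing is left to cascade. *)
Lemma settled l v : run G l -> top G l v -> 6 <= vclass l (vitem G v) ->
  {in V, forall u, dead l u = (u \in processed l)}.
Proof.
move=> r tv c6.
have nocl u : u \in V -> u \notin processed l -> 6 <= vclass l (vitem G u).
  by move=> uV uP; apply: leq_trans c6 (tv u uV uP).
have nf u : u \in V -> u \notin processed l -> ~~ forced l u.
  by move=> uV uP; apply/negP => /forced_class c1; move: (nocl u uV uP);
    rewrite c1.
have nd u : u \in V -> u \notin processed l -> 2 <= deg l u.
  move=> uV uP; rewrite ltnNge; apply/negP => /leaf_class c.
  by move: (nocl u uV uP) c; lia.
move=> u uV; rewrite /dead; case uP : (u \in processed l) => //=.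
have {}uP := negbT uP.
rewrite (negPf (nf u uV uP)) /= leqNgt (nd u uV uP) /=.
apply/negP => /or3P[] /hasP.
- case=> e el /and3P[ea ue /hasP[y yN /andP[yu /orP[yA|/andP[yP yf]]]]].
  + have : a_sibling l (vitem G u).
      apply/hasP; exists e => //; apply/and3P; split=> //.
        by rewrite /processed_neighbor /= nbrC -(nbhE r el).
      by apply/hasP; exists y => //; rewrite yu.
    by move=> /a_sibling_class c; move: (nocl u uV uP) c; lia.
  + have yV : y \in V by move: yN; rewrite (nbhE r el) => /nbrV.
    by move: (nf y yV yP); rewrite yf.
- case=> b bl /and3P[bb ba /hasP[y yb yu]].
  (* A processed [y] next to [u] rules out current degree 3, so that P4 applies to [u]; an
     unprocessed [y] is forced. *)
  case: (boolP (y \in processed l)) => yP.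
    have d2 : deg l u = 2.
      apply/eqP; rewrite eqn_leq nd // andbT leqNgt; apply/negP => d3.
      have [|_ /(_ y yu)] := @deg3P l u uV; last by rewrite yP.
      by apply/eqP; rewrite eqn_leq deg_le3.
    have /mapP[e el ye] := yP.
    have : vclass l (vitem G u) <= 4.
      apply: vclass4 => //; apply/hasP; exists e => //.
      rewrite /processed_neighbor /= -ye yu /=.
      by apply/hasP; exists b => //; rewrite bb ba -ye.
    by move=> c; move: (nocl u uV uP) c; lia.
  have yV : y \in V by exact: nbrV yu.
  have : forced l y.
    apply/forcedP; exists b => //; rewrite ba andbT nbrC.
    by rewrite -(nbhE r bl).
  by rewrite (negPf (nf y yV yP)).
- case=> w wu /and3P[wP _ wd]; have := nd w (nbrV wu) wP; lia.
Qed.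

Lemma processed_dead l u : u \in processed l -> dead l u.
Proof. by rewrite /dead => ->. Qed.

Lemma forced_dead l u : forced l u -> dead l u.
Proof. by rewrite /dead => ->; rewrite orbT. Qed.

Lemma leaf_dead l u : deg l u <= 1 -> dead l u.
Proof. by rewrite /dead => ->; rewrite !orbT. Qed.

Lemma near_leaf_dead l u : near_leaf l u -> dead l u.
Proof. by rewrite /dead => ->; rewrite !orbT. Qed.

Lemma sibling_dead l u : doomed_sibling l u -> dead l u.
Proof. by rewrite /dead => ->; rewrite !orbT. Qed.

Lemma near_bad_dead l u : near_rejected_bad l u -> dead l u.
Proof. by rewrite /dead => ->; rewrite !orbT. Qed.

Lemma two_unprocessed l w x y : x \in N w -> y \in N w -> x != y ->
  x \notin processed l -> y \notin processed l -> 2 <= deg l w.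
Proof.
move=> xw yw xy xP yP; rewrite /deg.
have -> : 2 = size [:: x; y] by [].
rewrite -size_filter; apply: uniq_leq_size; first by rewrite /= inE xy.
by move=> z; rewrite !inE mem_filter => /orP[]/eqP-> /=; rewrite ?xP ?yP.
Qed.

Lemma aanbrP l u : run G l ->
  reflect (exists e : entry, [/\ e \in l, aa e & u \in N (vname e)]) (aanbr l
    u).
Proof.
move=> r; apply: (iffP hasP) => [[e el /andP[ea ue]]|[e [el ea ue]]];
  exists e => //.
  by rewrite -(nbhE r el).
by rewrite ea (nbhE r el).
Qed.

(** * Deadness and weights are monotone along a run *)

Section Monotonicity.

Variables (l : log) (v : nat) (a : bool).
Hypotheses (rl : run G l) (vV : v \in V) (vP : v \notin processed l).
Hypothesis tv : top G l v.
Hypothesis acc_v : ~~ requests_advice l (vitem G v) ->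
       a = (vclass l (vitem G v) == 1) || (vclass l (vitem G v) == 6).

Let e := Entry (vitem G v) a (requests_advice l (vitem G v))
               (bad_vertex l (vitem G v)).
Let l' := e :: l.

Lemma run_step : run G l'. Proof. exact: run_cons. Qed.

Lemma deg_step u : deg l' u + (v \in N u) = deg l u.
Proof. exact: deg_cons. Qed.

Lemma forced_step u : forced l' u = (v \in N u) && ~~ a || forced l u.
Proof. by []. Qed.

Lemma forced_acc : forced l v -> a.
Proof.
move=> /forced_class c1; move: acc_v.
by rewrite /requests_advice c1 => ->.
Qed.

Lemma leaf_rejected : ~~ forced l v -> deg l v <= 1 -> a = false.
Proof.
move=> nf dv; move: acc_v; rewrite /requests_advice.
have /orP[/eqP->|/eqP->] : (vclass l (vitem G v) == 2) || (vclass l (vitem G v)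
  == 3).
  by case: (vclassP l vV) nf dv => //; first (by move=> ->); move=> *; exfalso;
    lia.
  by move=> ->.
by move=> ->.
Qed.

(** Each cause of death persists or is replaced by another. A forced sibling is accepted once it is
    processed. A leaf [w] is rejected once it is processed, which forces [u]. As long as [u] stays
    unprocessed, [w] cannot become forced instead: the newly rejected vertex would have been a
    second unprocessed neighbor of [w]. *)
Lemma dead_mono u : u \in V -> dead l u -> dead l' u.
Proof.
move=> uV; case: (leqP 6 (vclass l (vitem G v))) => c.
  by rewrite (settled rl tv c) // => uP; rewrite /dead inE uP orbT.
rewrite {1}/dead; case/or4P => [uP|fu|du|].
- by apply: processed_dead; rewrite inE uP orbT.
- by apply: forced_dead; rewrite forced_step fu orbT.
- by apply: leaf_dead; have := deg_step u; lia.
case/or3P => [/hasP[e0 e0l /and3P[ea ue /hasP[y ye /andP[yu Hy]]]]||].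
- apply/sibling_dead/hasP; exists e0; first by rewrite inE e0l orbT.
  apply/and3P; split=> //; apply/hasP; exists y; rewrite // yu andTb.
  case/orP: Hy => [yA|/andP[yP yf]].
    by apply/orP; left; rewrite /accepted /=; case: (a) => //=;
      rewrite inE yA orbT.
  case: (eqVneq y v) => [yv|yv].
    subst y; apply/orP; left; rewrite /accepted /=.
    by rewrite (forced_acc yf) /= inE eqxx.
  by apply/orP; right; rewrite inE negb_or yv yP forced_step yf orbT.
- case/hasP=> b bl Hb; apply/near_bad_dead/hasP; exists b => //.
  by rewrite inE bl orbT.
case/hasP=> w wu /and3P[wP wf wd].
case: (eqVneq u v) => [->|uv]; first by apply: processed_dead; rewrite inE eqxx.
case: (boolP (u \in processed l)) => uP.
  by apply: processed_dead; rewrite inE uP orbT.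
case: (eqVneq w v) => [wv|wv].
  subst w; apply: forced_dead; rewrite forced_step.
  by rewrite (leaf_rejected wf wd) wu.
apply/near_leaf_dead/hasP; exists w => //.
rewrite inE negb_or wv wP forced_step negb_or wf andbT /=.
have := deg_step w => dw; apply/andP; split; last by lia.
rewrite andbT; apply/negP => /andP[vw _].
have := @two_unprocessed l w u v; rewrite (nbrC u) wu vw uv uP vP.
by move=> /(_ isT isT isT isT isT); lia.
Qed.

Lemma live_mono u : live l' u <= live l u.
Proof.
apply: count_sub => z zu /=; apply: contra; exact: dead_mono (nbrV zu).
Qed.

Lemma live_le3 k u : u \in V -> live k u <= 3.
Proof. by move=> uV; apply: leq_trans (count_size _ _) (size_nbr uV). Qed.

Lemma aanbr_step u : aanbr l' u = aa e && (u \in N v) || aanbr l u.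
Proof. by []. Qed.

Lemma phi_le7 k M u : phi k M u <= 7.
Proof. rewrite /phi; case: (dead k u) => //; case: (aanbr _ _); case: (M u);
  clear; lia. Qed.

(** If [u] survives, the left side is its new weight; if [u] dies, the left side is at most 3 + 2 +
    2 = 7, the weight of a dead vertex. *)
Lemma phi_step M u : u \in V -> ~~ dead l u ->
  phi l M u + (live l u - live l' u) + (aanbr l' u && ~~ aanbr l u).*2
    <= phi l' M u.
Proof.
move=> uV du; rewrite /phi (negPf du); have := live_mono u.
have := live_le3 l uV; rewrite aanbr_step.
case: (aa e && _); case: (aanbr l u); case: (M u); case: (dead l' u); lia.
Qed.

Lemma phi_mono M u : u \in V -> phi l M u <= phi l' M u.
Proof.
move=> uV; case: (boolP (dead l u)) => du.
  by rewrite /phi du (dead_mono uV du).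
by apply: leq_trans (phi_step _ _ _) => //; rewrite -addnA leq_addr.
Qed.

End Monotonicity.

Lemma phi_dead l M u : dead l u -> phi l M u = 7.
Proof. by rewrite /phi => ->. Qed.

Lemma Phi_gain l M l' M' (ps : seq (nat * nat)) :
  {in ps, forall p, p.1 \in V} ->
  {in V, forall u, phi l M u + \sum_(p <- ps) (p.1 == u) * p.2 <= phi l' M' u}
    ->
  Phi l M + \sum_(p <- ps) p.2 <= Phi l' M'.
Proof.
move=> psV H; apply: (@leq_trans (\sum_(u <- V) (phi l M u + \sum_(p <- ps)
  (p.1 == u) * p.2))).
  rewrite big_split /= leq_add2l exchange_big /= big_seq [leqRHS]big_seq.
  apply: leq_sum => p pps.
  by rewrite (bigD1_seq p.1) ?psV ?fset_uniq //= eqxx mul1n leq_addr.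
rewrite big_seq [leqRHS]big_seq; exact: leq_sum.
Qed.

Lemma Phi_gain_uniq l M l' M' (s : seq nat) k : uniq s ->
  {subset s <= V} -> {in V, forall u, phi l M u <= phi l' M' u} ->
  {in s, forall u, phi l M u + k <= phi l' M' u} ->
  Phi l M + k * size s <= Phi l' M'.
Proof.
move=> us sV H Hs; have := @Phi_gain l M l' M' [seq (u, k) | u <- s].
rewrite !big_map big_const_seq iter_addn_0 count_predT; apply.
  by move=> p /mapP[u us' ->]; exact: sV.
move=> u uV; rewrite big_map /=; case: (boolP (u \in s)) => uss.
  rewrite (bigD1_seq u) //= eqxx mul1n big1 ?addn0 ?Hs // => w /negPf->.
  by rewrite mul0n.
rewrite big_seq big1 ?addn0 ?H // => w ws.
by case: eqP => [E|]; rewrite ?mul0n //; rewrite -E ws in uss.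
Qed.

Lemma Phi_mono l M l' M' : {in V, forall u, phi l M u <= phi l' M' u} ->
  Phi l M <= Phi l' M'.
Proof. by move=> H; rewrite /Phi big_seq [leqRHS]big_seq; apply: leq_sum. Qed.

Lemma processed_cons (e : entry) l u :
  (u \in processed (e :: l)) = (u == vname e) || (u \in processed l).
Proof. by []. Qed.

(** * The invariant, and the steps without advice *)

Definition bits (l : log) := count ad l.

(* Marked vertices have no neighbor of current degree 3, now or later; hence no
   neighbor of a vertex that requests advice is marked, and no unmarked active
   vertex is next to a marked one. *)
Record marking (l : log) (M : pred nat) : Prop := Marking {
  marked_aa : forall u, M u -> aanbr l u;
  marked_deg : forall m y, M m -> m \notin processed l -> y \in N m ->
    y \notin processed l -> deg l y <= 2;
  marked_nbr : forall m y, M m -> m \notin processed l -> y \in N m ->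
    y \notin processed l -> [|| M y, deg l y <= 1 | ~~ aanbr l y];
  marked_sib : forall (e : entry) u y, e \in l -> aa e -> u \in N (vname e) ->
    y \in N (vname e) -> u \notin processed l -> y \notin processed l ->
    M u -> M y
}.

Definition two_acts l M (e : entry) := exists p q,
  [/\ p != q, p \in N (vname e), q \in N (vname e), act l M p & act l M q].

(* The state after a P8-acceptance followed by a P7-acceptance that shares one
   neighbor with it. *)
Definition two_pairs l M (e1 e2 : entry) :=
  [/\ [/\ e1 \in l, e2 \in l, aa e1 & aa e2],
      (forall u, act l M u -> (u \in N (vname e1)) || (u \in N (vname e2))),
      two_acts l M e1 & two_acts l M e2].

(* The state after the acceptance of a P8-vertex with three neighbors of degree
   3. *)
Definition one_triple l M (e : entry) :=
  [/\ e \in l /\ aa e, {in V, forall u, dead l u = (u \in processed l)},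
      (forall u, u \in N (vname e) -> act l M u) &
      (forall u, act l M u -> u \in N (vname e))].

(* The next vertex is the leaf [w]: its neighbor [x] gets forced, so that the
   sibling [s] of [x] dies, which costs one active vertex but not [r]. *)
Definition pending l M :=
  exists w x (e : entry) s r,
  [/\ [/\ w \in V, w \notin processed l, ~~ forced l w & deg l w <= 1],
      {in V, forall u, u \notin processed l -> u != w ->
         (2 <= deg l u) && ~~ forced l u},
      x \in N w /\ x \notin processed l,
      [/\ e \in l, aa e, x \in N (vname e), s \in N (vname e) & s != x] &
      [/\ act l M s, act l M r & r != s]].

Definition slack l M k := 22 * bits l <= Phi l M + k.

Inductive bounded l M : Prop :=
| Bounded0 of slack l M 0
| Bounded2 r of act l M r & slack l M 2
| Bounded4 e1 e2 of two_pairs l M e1 e2 & slack l M 4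
| Bounded6 e of one_triple l M e & slack l M 6
| BoundedP of pending l M & slack l M 4.

Lemma act_V l M u : run G l -> act l M u -> u \in V.
Proof.
by move=> rl /and3P[_ /(aanbrP _ rl)[e [_ _ /nbrV]]].
Qed.

Lemma notdead l u : ~~ dead l u ->
  [/\ u \notin processed l, ~~ forced l u & 2 <= deg l u].
Proof.
by rewrite /dead !negb_or -ltnNge => /andP[? /andP[? /andP[? _]]].
Qed.

Lemma act_phi l M u : act l M u -> phi l M u <= 5.
Proof.
by move=> /and3P[/negPf du au /negPf mu]; rewrite /phi du au mu /=; lia.
Qed.

Lemma requests_deg l v : v \in V -> requests_advice l (vitem G v) ->
  deg l v = 3 /\ 7 <= vclass l (vitem G v).
Proof. by move=> vV; rewrite /requests_advice; case: (vclassP l vV). Qed.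

(** A neighbor of a bad-vertex was already next to a contributing vertex, so two of its at most
    three neighbors are processed. This serves to show that an aa-vertex next to an unprocessed
    vertex of current degree at least 2 was not bad. *)
Lemma bad_nbr l : run G l -> forall (e : entry) u, e \in l -> bad e ->
  u \in N (vname e) -> u \notin processed l -> deg l u <= 1.
Proof.
elim=> // {}l v a rl IH vV vP _ _ e u; rewrite in_cons processed_cons negb_or.
move=> H be ue /andP[uv uP]; case/orP: H => [/eqP E|el]; last first.
  have := IH _ _ el be ue uP.
  have := @deg_cons (Entry (vitem G v) a (requests_advice l (vitem G v))
               (bad_vertex l (vitem G v))) l u vP; lia.
move: be ue; rewrite {}E /vname /= => /andP[_ /allP cnb] ue.
have uV := nbrV ue; have := cnb u ue.
case/andP=> _ /hasP[e0 e0l /andP[/and3P[ea _ _] ue0]].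
have : deg l u <= 2.
  by apply: aanbr_deg => //; apply/hasP; exists e0 => //; rewrite ea.
have := @deg_cons (Entry (vitem G v) a (requests_advice l (vitem G v))
               (bad_vertex l (vitem G v))) l u vP.
by rewrite /vname /= nbrC ue; lia.
Qed.

Lemma aa_size l : run G l -> forall e : entry, e \in l -> aa e ->
  size (N (vname e)) = 3.
Proof.
elim=> // {}l v a rl IH vV vP _ _ e; rewrite in_cons => /orP[/eqP->|/IH//].
by rewrite /aa /vname /= => /andP[/(requests_deg vV)[d3 _] _];
  have [] := deg3P vV d3.
Qed.

Section LowStep.

Variables (l : log) (v : nat) (a : bool).
Hypotheses (rl : run G l) (vV : v \in V) (vP : v \notin processed l).
Hypothesis tv : top G l v.
Hypothesis acc_v : ~~ requests_advice l (vitem G v) ->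
       a = (vclass l (vitem G v) == 1) || (vclass l (vitem G v) == 6).

Local Notation e := (Entry (vitem G v) a (requests_advice l (vitem G v))
               (bad_vertex l (vitem G v))).
Local Notation l' := (e :: l).

Lemma processed_step u : (u \in processed l') = (u == v) || (u \in processed l).
Proof. by rewrite inE. Qed.

Lemma deg_step_le u : deg l' u <= deg l u.
Proof. by rewrite -(deg_step a vP u) leq_addr. Qed.

(** A vertex requesting advice has current degree 3, hence no marked neighbor by [marked_deg], so a
    new aa-vertex has no unprocessed marked neighbor. If a neighbor of a marked vertex gets its
    first aa-neighbor now, it had current degree at most 2 and becomes a leaf. *)
Lemma marking_step M : marking l M -> marking l' M.
Proof.
case=> aaM degM nbrM sibM; split.
- by move=> u /aaM; rewrite aanbr_cons => ->; rewrite orbT.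
- move=> m y mM; rewrite !processed_step => /norP[_ mP] ym /norP[_ yP].
  by apply: leq_trans (deg_step_le y) (degM m y mM mP ym yP).
- move=> m y mM; rewrite !processed_step => /norP[mv mP] ym /norP[_ yP].
  case/or3P: (nbrM m y mM mP ym yP) => [->//|yd|].
    by rewrite (leq_trans (deg_step_le y) yd) orbT.
  rewrite aanbr_step negb_or => ->; rewrite andbT.
  case: (boolP (_ && _)) => [/andP[_ yv]|_]; last by rewrite !orbT.
  have := degM m y mM mP ym yP; have := deg_step a vP y; rewrite nbrC yv.
  by case: (deg l' y) => [|[|]] //; rewrite ?orbT //; lia.
- move=> e0 u y; rewrite !processed_step in_cons => H ea ue ye.
  move=> /norP[uv uP] /norP[yv yP] uM; case/orP: H => [/eqP E|el]; last first.
    exact: (sibM e0 u).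
  move: ea ue; rewrite {}E /aa /vname /= => /andP[/(requests_deg vV)[d3 _] _]
    uv'.
  by have := degM u v uM uP; rewrite nbrC => /(_ uv' vP); rewrite d3.
Qed.

Lemma act_lost M u : u \in V -> act l M u -> ~~ act l' M u ->
  phi l M u + 2 <= phi l' M u.
Proof.
move=> uV ua una; have := act_phi ua; case/and3P: ua => du aau mu.
suff : dead l' u by move=> /(phi_dead M) ->; lia.
move: una; rewrite /act mu aanbr_step aau orbT !andbT negbK //.
Qed.

Section LowClass.

Hypothesis c5 : vclass l (vitem G v) <= 5.

Lemma low_ad : requests_advice l (vitem G v) = false.
Proof. by rewrite /requests_advice; case: eqP c5 => [->//|_];
  case: eqP => [->//|]. Qed.

Lemma low_act M u : act l' M u -> act l M u.
Proof.
case/and3P=> du; rewrite aanbr_step /aa /= low_ad /= => au mu.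
have uV : u \in V by move/(aanbrP _ rl): au => [e0 [_ _ /nbrV]].
rewrite /act au mu !andbT; apply: contra du; exact: dead_mono.
Qed.

Lemma low_bits : bits l' = bits l.
Proof. by rewrite /bits /= low_ad. Qed.

Lemma low_slack M k : slack l M k -> slack l' M k.
Proof.
rewrite /slack low_bits => H; apply: leq_trans H _; rewrite leq_add2r.
by apply: Phi_mono => u uV; exact: phi_mono.
Qed.

Lemma low_slack_lost M (s : seq nat) k : uniq s -> {subset s <= V} ->
  {in s, forall u, act l M u && ~~ act l' M u} ->
  slack l M (2 * size s + k) -> slack l' M k.
Proof.
move=> us sV Hs; rewrite /slack low_bits => H; apply: leq_trans H _.
rewrite addnA leq_add2r; apply: Phi_gain_uniq => //.
  by move=> u uV; exact: phi_mono.
by move=> u us'; case/andP: (Hs u us') => ua una; exact: act_lost (sV u us') ua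
  una.
Qed.

(** The death of [s] repays 2; then either [r] remains as the witness for slack 2, or its death
    repays the rest. *)
Lemma low_bounded2 M r s : act l M r -> act l M s -> r != s -> ~~ act l' M s ->
  slack l M 4 -> bounded l' M.
Proof.
move=> ra sa rs sna H.
case: (boolP (act l' M r)) => ra'.
  apply: (@Bounded2 _ _ r) => //; apply: (@low_slack_lost M [:: s] 2) => //.
    by move=> u; rewrite inE => /eqP->; exact: act_V sa.
  by move=> u; rewrite inE => /eqP->; rewrite sa.
apply: Bounded0; apply: (@low_slack_lost M [:: r; s] 0) => //=.
- by rewrite inE rs.
- by move=> u; rewrite !inE => /orP[]/eqP->; apply: act_V; eauto.
- by move=> u; rewrite !inE => /orP[]/eqP->; rewrite ?ra ?sa.
Qed.

Lemma low_dead : dead l v.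
Proof.
case: (vclassP l vV) c5 => //.
- by move=> /forced_dead->.
- by move=> _ d _; apply: leaf_dead; rewrite d.
- by move=> _ d _; apply: leaf_dead; rewrite d.
- move=> _ d /hasP[e0 el /andP[ve /hasP[b bl /and3P[bb ba eb]]]] _.
  apply/near_bad_dead/hasP; exists b => //; rewrite bb ba /=.
  by apply/hasP; exists (vname e0).
- move=> _ d /hasP[e0 el /and3P[ea ve /hasP[y ye /andP[yv yA]]]] _.
  apply/sibling_dead/hasP; exists e0 => //; rewrite ea (nbhE rl el) nbrC.
  by rewrite /processed_neighbor in ve; rewrite ve /=; apply/hasP; exists y;
    rewrite -?(nbhE rl el) // yv yA.
Qed.

(** Without a new aa-vertex no vertex becomes active, and an active vertex that is lost has died and
    repays 2. A pair that loses one vertex still offers the other as a witness. *)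
Lemma low_bounded M : bounded l M -> bounded l' M.
Proof.
case=> [H|r ra H|e1 e2 [He cov [p [q [pq p1 q1 pa qa]]] [p' [q' [pq' p2 q2 pa'
  qa']]]] H|e1 [_ D _ _] _|].
- by apply: Bounded0; exact: low_slack.
- case: (boolP (act l' M r)) => ra'.
    by apply: (@Bounded2 _ _ r) => //; exact: low_slack.
  apply: Bounded0; apply: (@low_slack_lost M [:: r] 0) => //=.
    by move=> u; rewrite inE => /eqP->; exact: act_V ra.
  by move=> u; rewrite inE => /eqP->; rewrite ra.
- case: (boolP (act l' M p)) => pa1; last first.
    by apply: (@low_bounded2 M q p) => //; rewrite eq_sym.
  case: (boolP (act l' M q)) => qa1; last by apply: (@low_bounded2 M p q).
  case: (boolP (act l' M p')) => pa1'; last first.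
    by apply: (@low_bounded2 M q' p') => //; rewrite eq_sym.
  case: (boolP (act l' M q')) => qa1'; last by apply: (@low_bounded2 M p' q').
  apply: (@Bounded4 _ _ e1 e2); last exact: low_slack.
  case: He => el1 el2 ea1 ea2; split; rewrite ?inE ?el1 ?el2 ?orbT //.
  + by move=> u /low_act/cov.
  + by exists p, q.
  + by exists p', q'.
(* In this shape only processed vertices are dead, whereas a vertex of class at most 5 is dead
   before it is received. *)
- by move: low_dead; rewrite D // (negPf vP).
case=> w [x [e0 [s [r [[wV wP wf wd] others [xw xP] [el ea xe se sx] [sa ra
  rs]]]]]] H.
(* All other unprocessed vertices have class at least 4, so the leaf comes next. *)
have vw : v = w.
  apply/eqP/negPn/negP => vw; have /andP[d2 nf] := others v vV vP vw.
  have : vclass l (vitem G v) <= 3 by exact: leq_trans (tv wV wP) (leaf_class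
    wd).
  by case: (vclassP l vV) d2 nf => // [->|_ ->|_ ->].
(* Rejecting the leaf forces [x], and the future acceptance of [x] dooms its sibling [s]. *)
subst w; apply: (@low_bounded2 M r s) => //.
apply/negP => /and3P[/negP nd _ _]; apply: nd; apply/sibling_dead/hasP.
exists e0; first by rewrite in_cons el orbT.
have el' : e0 \in l' by rewrite in_cons el orbT.
rewrite ea (nbhE (run_step rl vV vP tv acc_v) el') se /=.
apply/hasP; exists x => //; rewrite eq_sym sx andTb.
apply/orP; right; rewrite processed_step negb_or xP andbT.
rewrite {1}/rejected_neighbor /processed_neighbor /vname /= nbrC xw.
rewrite (leaf_rejected vV vP acc_v wf wd) andbT.
by apply/eqP => xv; move: xw; rewrite xv nbrxx.
Qed.

End LowClass.

End LowStep.

Lemma no_triangle u v w : u \in N v -> w \in N v -> u \in N w -> False.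
Proof.
rewrite !nbrE => vu vw wu; have := tf u v w.
by rewrite adj_sym vu vw /= adj_sym wu.
Qed.

Lemma other_nbr l n v : deg l n = 2 -> v \in N n -> v \notin processed l ->
  exists x, [/\ x \in N n, x != v, x \notin processed l &
    {in N n, forall y, y \notin processed l -> (y == v) || (y == x)}].
Proof.
move=> d2 vn vP; pose s := [seq z <- N n | z \notin processed l].
have us : uniq s by rewrite filter_uniq ?uniq_nbr.
have vs : v \in s by rewrite mem_filter vP.
have ss : size s = 2 by rewrite size_filter.
have : size (rem v s) = 1 by rewrite size_rem // ss.
case E: (rem v s) => [|x [|]] // _; exists x.
have xs : x \in rem v s by rewrite E mem_head.
move: xs; rewrite mem_rem_uniq // => /andP[xv]; rewrite mem_filter => /andP[xP
  xn].
split=> // y yn yP; case: eqVneq => //= yv.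
have : y \in rem v s by rewrite mem_rem_uniq // [_ \in _]andbC /= mem_filter yP
  yn.
by rewrite E inE.
Qed.

Definition mark (l : log) (M : pred nat) : pred nat :=
  fun u => (u \notin processed l) && aanbr l u || M u.

Section Settled.

Variables (l : log) (v : nat) (a : bool).
Hypotheses (rl : run G l) (vV : v \in V) (vP : v \notin processed l).
Hypothesis tv : top G l v.
Hypothesis acc_v : ~~ requests_advice l (vitem G v) ->
       a = (vclass l (vitem G v) == 1) || (vclass l (vitem G v) == 6).
Hypothesis c6 : 6 <= vclass l (vitem G v).

Local Notation e := (Entry (vitem G v) a (requests_advice l (vitem G v))
               (bad_vertex l (vitem G v))).
Local Notation l' := (e :: l).

Lemma settledE u : u \in V -> dead l u = (u \in processed l).
Proof. exact: (settled rl tv c6). Qed.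

Lemma alive u : u \in V -> u \notin processed l -> ~~ dead l u.
Proof. by move=> uV uP; rewrite settledE. Qed.

Lemma live_settled u : live l u = deg l u.
Proof. by apply: eq_in_count => z /nbrV zV /=; rewrite settledE. Qed.

Lemma deg_cases u : u \in V -> u \notin processed l ->
  deg l u = 2 \/ deg l u = 3.
Proof.
move=> uV uP; have [_ _ d2] := notdead (alive uV uP).
by have := deg_le3 l uV; move: d2; clear; lia.
Qed.

Lemma phi_settled M u : u \in V -> u \notin processed l ->
  phi l M u = 3 - deg l u + (aanbr l u).*2 + (M u).*2.
Proof. by move=> uV uP; rewrite /phi settledE // (negPf uP) live_settled. Qed.

Lemma phi_free M u : marking l M -> u \in V -> deg l u = 3 ->
  [/\ u \notin processed l, aanbr l u = false, M u = false & phi l M u = 0] \/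
    u \in processed l.
Proof.
move=> mM uV d; case: (boolP (u \in processed l)) => uP; [by right|left].
have na : aanbr l u = false.
  by apply/negP => /(aanbr_deg rl uV); rewrite d.
have nM : M u = false by apply/negP => /(marked_aa mM); rewrite na.
by rewrite phi_settled // d na nM.
Qed.

Lemma bounded_slack M : bounded l M -> slack l M 6.
Proof. by rewrite /slack; case=> [|? _|? ? _|? _|_] H; apply: leq_trans H _;
  rewrite leq_add2l. Qed.

Lemma marking_mark M : marking l M ->
  (forall m y, m \notin processed l -> aanbr l m -> y \in N m ->
     y \notin processed l -> deg l y <= 2) ->
  marking l (mark l M).
Proof.
case=> aaM degM nbrM sibM H; split.
- by move=> u /orP[/andP[_ ->]|/aaM].
- by move=> m y /orP[/andP[mP am]|mM] ? ym yP; [apply: (H m)|apply: (degM m)].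
- by move=> m y _ _ ym yP; rewrite /mark yP /=; case: (aanbr l y);
    rewrite //= !orbT.
- move=> e0 u y el ea ue ye uP yP _; rewrite /mark yP /=; apply/orP; left.
  by apply/(aanbrP _ rl); exists e0.
Qed.

(** The slacks 0, 2, 4, 6 come with at least 0, 1, 2, 3 active vertices, and marking one of them
    gains 2. A pending leaf would be dead without being processed. *)
Lemma bounded_mark M : marking l M -> bounded l M ->
  slack l (mark l M) 0.
Proof.
move=> mM; pose M' := mark l M; rewrite -/M'.
have mono u : u \in V -> phi l M u <= phi l M' u.
  move=> uV; rewrite /phi; case: (dead l u) => //; rewrite leq_add2l /M' /mark.
  by case: (M u); rewrite ?orbT // leq0n.
have gain u : act l M u -> phi l M u + 2 <= phi l M' u.
  move=> ua; have [/notdead[uP _ _] au /negPf mu] := and3P ua.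
  have uV := act_V rl ua.
  by rewrite !phi_settled // /M' /mark mu uP au /=; clear; lia.
have G_ s k : uniq s -> {in s, forall u, act l M u} ->
  slack l M (2 * size s + k) ->
    slack l M' k.
  move=> us sa; rewrite /slack => H; apply: leq_trans H _;
    rewrite addnA leq_add2r.
  apply: Phi_gain_uniq => // u us'; last exact/gain/sa.
  exact: act_V rl (sa u us').
case=> [H|r ra H|e1 e2 [_ _ [p [q [pq _ _ pa qa]]] _] H|e1 [[el ea] _ sub _]
  H|].
- by apply: (G_ [::]).
- by apply: (G_ [:: r]) => // u; rewrite inE => /eqP->.
- apply: (G_ [:: p; q]) => //=; first by rewrite inE pq.
  by move=> u; rewrite !inE => /orP[]/eqP->.
- apply: (G_ (enum_fset (N (vname e1)))) => //; first exact: uniq_nbr.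
  by rewrite (aa_size rl el ea).
case=> w [_ [_ [_ [_ [[wV wP _ wd] _ _ _ _]]]]].
by move: wP; rewrite -settledE // leaf_dead.
Qed.

Lemma unforced_settled u : u \in V -> u \notin processed l -> ~~ forced l u.
Proof. by move=> uV uP; have [] := notdead (alive uV uP). Qed.

Lemma mono_slack M k : requests_advice l (vitem G v) = false ->
  slack l M k -> slack l' M k.
Proof.
move=> rq; rewrite /slack; have -> : bits l' = bits l by rewrite /bits /= rq.
move=> H; apply: leq_trans H _.
by rewrite leq_add2r; apply: Phi_mono => u uV; exact: phi_mono.
Qed.

(** A vertex of current degree 3 has weight 0 here, so processing it gains 7, more than the largest
    slack. *)
Lemma class6_bounded M : vclass l (vitem G v) = 6 -> marking l M ->
  bounded l M -> bounded l' M.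
Proof.
move=> c mM /bounded_slack; rewrite /slack => H; apply: Bounded0;
  rewrite /slack.
have rq : requests_advice l (vitem G v) = false by rewrite /requests_advice c.
have d3 : deg l v = 3 by move: c; case: (vclassP l vV).
have [[_ _ _ p0]|] := phi_free mM vV d3; last by rewrite (negPf vP).
have bl : bits l' = bits l by rewrite /bits /= rq.
suff : Phi l M + 7 * size [:: v] <= Phi l' M by move: H; rewrite bl /=; lia.
apply: Phi_gain_uniq => //.
- by move=> u; rewrite inE => /eqP->.
- by move=> u uV; exact: phi_mono.
- move=> u; rewrite inE => /eqP->; rewrite p0.
  by rewrite (@phi_dead l') // processed_dead // processed_cons /vname eqxx.
Qed.

Lemma class9_bounded M : vclass l (vitem G v) = 9 -> marking l M ->
  bounded l M -> exists M', marking l' M' /\ bounded l' M'.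
Proof.
move=> c mM bM; exists (mark l M); split.
  apply: marking_step => //; apply: marking_mark => // m y mP am ym yP.
  have yV : y \in V := nbrV ym.
  have := tv yV yP; rewrite c; case: (vclassP l yV) => //; lia.
apply/Bounded0/mono_slack; first by rewrite /requests_advice c.
exact: bounded_mark.
Qed.

End Settled.

(** * Steps with advice *)

Section RequestCounts.

Variables (l : log) (v : nat) (a : bool).
Hypotheses (rl : run G l) (vV : v \in V) (vP : v \notin processed l).
Hypothesis tv : top G l v.
Hypothesis rq : requests_advice l (vitem G v).

Local Notation e := (Entry (vitem G v) a (requests_advice l (vitem G v))
               (bad_vertex l (vitem G v))).
Local Notation l' := (e :: l).

Lemma rq_class : 7 <= vclass l (vitem G v).
Proof. by have [] := requests_deg vV rq. Qed.

Lemma rq_deg : deg l v = 3.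
Proof. by have [] := requests_deg vV rq. Qed.

Lemma rq_class6 : 6 <= vclass l (vitem G v).
Proof. exact: ltnW rq_class. Qed.

Lemma rq_acc : ~~ requests_advice l (vitem G v) ->
       a = (vclass l (vitem G v) == 1) || (vclass l (vitem G v) == 6).
Proof. by rewrite rq. Qed.

Lemma rq_bits : bits l' = (bits l).+1.
Proof. by rewrite /bits /= rq. Qed.

Let aliveP := alive rl tv rq_class6.
Lemma rq_nbrP n : n \in N v -> n \notin processed l.
Proof. by have [_] := deg3P vV rq_deg; apply. Qed.

Lemma rq_size : size (N v) = 3.
Proof. by have [] := deg3P vV rq_deg. Qed.

Lemma live_drop u (t : seq nat) : uniq t -> u \in V ->
  {in t, forall z, [&& z \in N u, z \notin processed l & dead l' z]} ->
  live l' u + size t <= live l u.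
Proof.
move=> ut uV tP; rewrite /live -!size_filter -size_cat.
apply: uniq_leq_size.
  rewrite cat_uniq ut filter_uniq ?uniq_nbr //= andbT.
  apply/hasPn => z /tP/and3P[_ _ zd]; rewrite mem_filter /=.
  by rewrite zd.
move=> z; rewrite mem_cat !mem_filter /= => /orP[/andP[zd zu]|/tP/and3P[zu zP
  _]].
  rewrite zu andbT; apply: contra zd.
  exact: (dead_mono rl vV vP tv rq_acc (nbrV zu)).
by rewrite zu andbT; apply: aliveP => //; exact: nbrV zu.
Qed.

Variable M : pred nat.
Hypothesis mM : marking l M.

Lemma rq_nbrM n : n \in N v -> M n = false.
Proof.
move=> nv; apply/negP => nM; have vn : v \in N n by rewrite nbrC.
by have := marked_deg mM nM (rq_nbrP nv) vn vP; rewrite rq_deg.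
Qed.

Lemma rq_phi : phi l M v = 0.
Proof.
by have [[]|] := phi_free rl tv rq_class6 mM vV rq_deg; rewrite // (negPf vP).
Qed.

(* The neighbors of the requesting vertex: active, ordinary (current degree 2
   without aa-neighbor) and free (current degree 3). *)
Definition n_act := count (aanbr l) (N v).
Definition n_ord := count [pred n | (deg l n == 2) && ~~ aanbr l n] (N v).
Definition n_free := count [pred n | deg l n == 3] (N v).

Variant nbr_spec n : bool -> bool -> bool -> nat -> Prop :=
| NbrAct of act l M n & deg l n = 2 : nbr_spec n true false false 3
| NbrOrd of ~~ aanbr l n & deg l n = 2 : nbr_spec n false true false 1
| NbrFree of ~~ aanbr l n & deg l n = 3 : nbr_spec n false false true 0.

Lemma nbr_specP n : n \in N v ->
  nbr_spec n (aanbr l n) ((deg l n == 2) && ~~ aanbr l n) (deg l n == 3) (phi l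
    M n).
Proof.
move=> nv; have nV := nbrV nv; have nP := rq_nbrP nv.
rewrite (phi_settled rl tv rq_class6) // rq_nbrM //.
case: (boolP (aanbr l n)) => an.
  have d2 : deg l n = 2.
    have := aanbr_deg rl nV an.
    by case: (deg_cases rl tv rq_class6 nV nP) => -> .
  rewrite d2; apply: NbrAct => //; rewrite /act an rq_nbrM //= andbT.
  exact: aliveP.
by case: (deg_cases rl tv rq_class6 nV nP) => d; rewrite d;
  [apply: NbrOrd | apply: NbrFree].
Qed.

Lemma n_total : n_act + n_ord + n_free = 3.
Proof.
have H (s : seq nat) : {subset s <= N v} ->
    count (aanbr l) s + count [pred n | (deg l n == 2) && ~~ aanbr l n] s
      + count [pred n | deg l n == 3] s = size s.
  elim: s => //= n s IH sub.
  have := IH (fun z zs => sub z (mem_behead (s := n :: s) zs)).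
  by case: (nbr_specP (sub n (mem_head _ _))); clear; lia.
by rewrite /n_act /n_ord /n_free H // rq_size.
Qed.

Lemma sum_nbr (f : nat -> nat) (x y z : nat) :
  {in N v, forall n, x * aanbr l n + y * ((deg l n == 2) && ~~ aanbr l n)
                     + z * (deg l n == 3) <= f n} ->
  x * n_act + y * n_ord + z * n_free <= \sum_(n <- N v) f n.
Proof.
move=> H; suff K (s : seq nat) : {subset s <= N v} ->
  x * count (aanbr l) s + y * count [pred n | (deg l n == 2) && ~~ aanbr l n] s
    + z * count [pred n | deg l n == 3] s <= \sum_(n <- s) f n by exact: K.
elim: s => [|n s IH] sub; first by rewrite !muln0.
have {}IH := IH (fun z zs => sub z (mem_behead (s := n :: s) zs)).
by rewrite big_cons /=; move: IH (H n (sub n (mem_head _ _))); clear; lia.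
Qed.

End RequestCounts.

(** * The weight gained by a requested rejection or acceptance *)

Section RejectGain.

Variables (l : log) (v : nat).
Hypotheses (rl : run G l) (vV : v \in V) (vP : v \notin processed l).
Hypothesis tv : top G l v.
Hypothesis rq : requests_advice l (vitem G v).

Local Notation e := (Entry (vitem G v) false (requests_advice l (vitem G v))
               (bad_vertex l (vitem G v))).
Local Notation l' := (e :: l).
Variable M : pred nat.
Hypothesis mM : marking l M.

Lemma reject_forced n : n \in N v -> forced l' n.
Proof. by move=> nv; rewrite forced_cons /vname /= nbrC nv. Qed.

(* Each active, ordinary or free neighbor contributes its own missing weight (4,
   6 or 7) and 1 for each of its other neighbors. *)
Lemma reject_gain y (b : bool) :
  (b -> [/\ y \in V, y \notin processed l, y != v, y \notin N v & M y = false
    /\ dead l' y]) ->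
  Phi l M + (7 + 5 * n_act l v + 7 * n_ord l v + 9 * n_free l v + 2 * b)
    <= Phi l' M.
Proof.
move=> Hb.
(* The share of [u] in the claimed gain: 7 for [v], the missing weight for a neighbor of [v], 1 per
   common neighbor for a vertex at distance two, and the bonus 2 for [y]. *)
pose g u := (u == v) * 7 + \sum_(n <- N v) ((n == u) * (7 - phi l M n)
   + ((u \in N n) && (u \notin processed l'))) + (b && (u == y)) * 2.
have acc := @rq_acc l v false rq.
have c6 := rq_class6 vV rq.
apply: (@leq_trans (\sum_(u <- V) (phi l M u + g u))); last first.
  rewrite big_seq [leqRHS]big_seq; apply: leq_sum => u uV;
    rewrite /g big_split /=.
  rewrite sum_indicator ?uniq_nbr //.
  have mono : phi l M u <= phi l' M u by apply: phi_mono.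
  case: (eqVneq u v) => [->|uv].
    rewrite nbrxx big1 => [|n _]; last by rewrite processed_cons eqxx andbF.
    rewrite (rq_phi rl vV vP tv rq mM) phi_dead; last first.
      by apply: processed_dead; rewrite processed_cons eqxx.
    case: (boolP (b && _)) => // /andP[/Hb[_ _]]; by rewrite eq_sym => /negPf->.
  rewrite mul0n add0n; case: (boolP (u \in N v)) => uNv.
    (* By triangle-freeness, a neighbor of [v], whose missing weight is already spent, receives
       nothing from the other neighbors of [v]. *)
    rewrite big_seq big1 => [|n nv]; last first.
      by case: (boolP (u \in N n)) => // un; case: (no_triangle uNv nv un).
    rewrite (@phi_dead l') ?forced_dead ?reject_forced // addn0.
    have -> : b && (u == y) = false.
      by apply/negP => /andP[/Hb[_ _ _ yN _] /eqP E]; rewrite -E uNv in yN.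
    by have := phi_le7 l M u; clear; lia.
  rewrite add0n; case: (boolP (u \in processed l)) => uP.
    rewrite big1 => [|n _]; last by rewrite processed_cons uP orbT andbF.
    have -> : b && (u == y) = false.
      by apply/negP => /andP[/Hb[_ yP _ _ _] /eqP E]; rewrite -E uP in yP.
    by rewrite addn0.
  have uP' : u \notin processed l' by rewrite processed_cons negb_or uv.
  have -> : \sum_(n <- N v) ((u \in N n) && (u \notin processed l')) =
             count [pred n | n \in N v] (N u).
    rewrite (count_mem_sym (uniq_nbr v) (uniq_nbr u)) -sum1_count
      [RHS]big_mkcond /=; apply: eq_bigr => n _.
    by rewrite uP' andbT nbrC; case: (n \in N u).
  have sub t : {subset filter [pred n | n \in N v] (N u) <= t} ->
      count [pred n | n \in N v] (N u) <= size t.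
    move=> H; rewrite -size_filter; apply: uniq_leq_size => //.
    by rewrite filter_uniq ?uniq_nbr.
  (* The unmarked [y] weighs at most 3 - deg + 2 and receives at most deg from its neighbors in
     [N v], so a bonus of 2 still fits below 7. *)
  case: (boolP (b && _)) => [/andP[/Hb[_ _ _ _ [My Dy]] /eqP E]|_].
    subst y; rewrite (@phi_dead l') // (phi_settled rl tv c6) // My.
    have : count [pred n | n \in N v] (N u) <= deg l u.
      rewrite [leqRHS]/deg -[leqRHS]size_filter; apply: sub => n;
        rewrite !mem_filter /=.
      by move=> /andP[nv ->]; rewrite (rq_nbrP vV rq nv).
    case: (deg_cases rl tv c6 uV uP) => d; rewrite d; last first.
      have -> : aanbr l u = false; last by lia.
      by apply/negP => /(aanbr_deg rl uV); rewrite d.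
    by case: (aanbr l u); lia.
  rewrite addn0; apply: leq_trans _ (phi_step rl vV vP tv acc M uV (alive rl tv
    c6 uV uP)).
  have := @live_drop l v false rl vV vP tv rq u (filter [pred n | n \in N v] (N
    u)).
  rewrite size_filter filter_uniq ?uniq_nbr // => /(_ isT uV).
  have H : {in [seq x <- N u | [pred n in N v] x], forall z,
     [&& z \in N u, z \notin processed l & dead l' z]}.
    move=> z; rewrite mem_filter /= => /andP[zv ->].
    by rewrite (rq_nbrP vV rq zv) forced_dead ?reject_forced.
  move=> /(_ H) D; rewrite -addnA leq_add2l.
  apply: leq_trans (leq_addr _ _); rewrite leq_subRL; first exact: D.
  exact: live_mono.
rewrite big_split /= leq_add2l /g !big_split /= exchange_big /=.
have -> : \sum_(u <- V) (u == v) * 7 = 7.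
  by rewrite (sum_indicator _ (fun=> 7)) ?fset_uniq // vV.
have -> : \sum_(u <- V) (b && (u == y)) * 2 = 2 * b.
  case: (boolP b) => [/Hb[yV _ _ _ _]|_] /=; last by rewrite big1.
  by rewrite (sum_indicator _ (fun=> 2)) ?fset_uniq // yV.
set S := \sum_(n <- N v) _.
suff : 5 * n_act l v + 7 * n_ord l v + 9 * n_free l v <= S by clear; lia.
apply: sum_nbr => // n nv; rewrite big_split /=.
have -> : \sum_(u <- V) (n == u) * (7 - phi l M n) = 7 - phi l M n.
  under eq_bigr => u _ do rewrite eq_sym.
  by rewrite (sum_indicator _ (fun=> 7 - phi l M n)) ?fset_uniq // (nbrV nv)
    mul1n.
set T := \sum_(u <- V) _; have D : deg l n <= T.+1.
  have := @deg_step l v false vP n; rewrite nbrC nv addn1 => <-.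
  rewrite ltnS /deg; apply: (@leq_trans (count [pred u | (u \in N n) && (u
    \notin processed l')] V)).
    rewrite -!size_filter; apply: uniq_leq_size; first by rewrite filter_uniq
      ?uniq_nbr.
    by move=> z; rewrite !mem_filter /= => /andP[-> zn]; rewrite zn (nbrV zn).
  by rewrite -sum1_count [leqLHS]big_mkcond /=; apply: leq_sum => u _;
    case: ifP.
move: D; case: (nbr_specP rl vV vP tv rq mM nv) => _ d; rewrite d; clear; lia.
Qed.

End RejectGain.

Section AcceptGain.

Variables (l : log) (v : nat).
Hypotheses (rl : run G l) (vV : v \in V) (vP : v \notin processed l).
Hypothesis tv : top G l v.
Hypothesis rq : requests_advice l (vitem G v).

Local Notation e := (Entry (vitem G v) true (requests_advice l (vitem G v))
               (bad_vertex l (vitem G v))).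
Local Notation l' := (e :: l).
Variable M : pred nat.
Hypothesis mM : marking l M.

Let acc := @rq_acc l v true rq.
Let c6 := rq_class6 vV rq.

Lemma accept_forced u : forced l' u = forced l u.
Proof. by rewrite forced_cons andbF. Qed.

Lemma accept_aanbr u : aanbr l' u = (u \in N v) || aanbr l u.
Proof. by rewrite aanbr_cons /aa /= rq. Qed.

Lemma accept_deg n : n \in N v -> (deg l' n).+1 = deg l n.
Proof. by move=> nv; rewrite -(deg_step true vP n) nbrC nv addn1. Qed.

Lemma accept_deg_out n : n \notin N v -> deg l' n = deg l n.
Proof. by move=> nv; rewrite -(deg_step true vP n) nbrC (negPf nv) addn0. Qed.

(* The vertices of [s] die at once; [z] is a neighbor of one of them. *)
Lemma accept_gain (s : seq nat) z (b : bool) : uniq s ->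
  (forall x, x \in s -> [/\ x \in V, x != v, x \notin N v & dead l' x]) ->
  (b -> [/\ z \in V, z \notin processed l, z != v, z \notin s &
        (z \in N v -> deg l z = 3) /\
        exists2 x, x \in s & (x \in N z) && (x \notin processed l)]) ->
  Phi l M + (7 + 4 * n_act l v + 6 * n_ord l v + 3 * n_free l v
     + \sum_(x <- s) (7 - phi l M x) + b) <= Phi l' M.
Proof.
move=> us Hs Hb.
(* A neighbor of degree 2 becomes a leaf and dies. A free one gains 2 for its first aa-neighbor and
   1 for losing the live neighbor [v]. *)
pose gn n := if deg l n == 2 then 7 - phi l M n else 3.
pose g u := (u == v) * 7 + \sum_(n <- N v) (n == u) * gn n
   + \sum_(x <- s) (x == u) * (7 - phi l M x) + (b && (u == z)).
have deadv : dead l' v by apply: processed_dead; rewrite processed_cons eqxx.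
apply: (@leq_trans (\sum_(u <- V) (phi l M u + g u))); last first.
  rewrite big_seq [leqRHS]big_seq; apply: leq_sum => u uV; rewrite /g.
  rewrite !sum_indicator ?uniq_nbr //.
  have mono : phi l M u <= phi l' M u by apply: phi_mono.
  case: (eqVneq u v) => [->|uv].
    rewrite nbrxx (rq_phi rl vV vP tv rq mM) (@phi_dead l') //.
    have -> : (v \in s) = false by apply/negP => /Hs[_ /eqP].
    case: (boolP (b && _)) => // /andP[/Hb[_ _ zv _ _]];
      by rewrite eq_sym (negPf zv).
  case: (boolP (u \in N v)) => uNv.
    have -> : (u \in s) = false by apply/negP => /Hs[_ _ /negP].
    rewrite /gn; have uP := rq_nbrP vV rq uNv.
    case: eqP => [d2|d2'].
      rewrite (@phi_dead l'); last first.
        by apply: leaf_dead; have := accept_deg uNv; rewrite d2 => -[->].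
      have -> : b && (u == z) = false; last by have := phi_le7 l M u; clear;
        lia.
      by apply/negP => /andP[/Hb[_ _ _ _ [dz _]] /eqP E]; subst u;
        rewrite dz in d2.
    case: (deg_cases rl tv c6 uV uP) => // d.
    have := phi_step rl vV vP tv acc M uV (alive rl tv c6 uV uP).
    rewrite accept_aanbr uNv.
    have -> : aanbr l u = false by apply/negP => /(aanbr_deg rl uV); rewrite d.
    have drop t := @live_drop l v true rl vV vP tv rq u t.
    (* If [z] is a free neighbor of [v], it loses both [v] and [x], which accounts for 3 + 1. *)
    case: (boolP (b && _)) => [/andP[/Hb[_ _ _ _ [_ [x xs /andP[xu xP]]]] /eqP
      E]|_].
      subst u; have [xV xv _ xd] := Hs x xs.
      have := drop [:: v; x]; rewrite /= inE eq_sym xv => /(_ isT uV).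
      have H : {in [:: v; x], forall z0, [&& z0 \in N z, z0 \notin processed l
        & dead l' z0]}.
        by move=> y; rewrite in_cons mem_seq1 => /orP[]/eqP->;
          rewrite ?xu ?xP ?xd // nbrC uNv vP.
      move=> /(_ H); move: (live l' z) (live l z) (phi l M z) (phi l' M z);
        clear; lia.
    have := drop [:: v] isT uV.
    have H : {in [:: v], forall z0, [&& z0 \in N u, z0 \notin processed l &
      dead l' z0]}.
      by move=> y; rewrite mem_seq1 => /eqP->; rewrite nbrC uNv vP.
    move=> /(_ H) /=; move: (live l' u) (live l u) (phi l M u) (phi l' M u);
      clear; lia.
  case: (boolP (u \in s)) => us'.
    have [_ _ _ ud] := Hs u us'; rewrite (@phi_dead l') //.
    have -> : b && (u == z) = false; last by have := phi_le7 l M u; clear; lia.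
    by apply/negP => /andP[/Hb[_ _ _ zs _] /eqP E]; rewrite -E us' in zs.
  case: (boolP (b && _)) => [/andP[/Hb[_ zP _ _ [_ [x xs /andP[xu xP]]]] /eqP
    E]|_]; last first.
    by move: mono; move: (phi l M u) (phi l' M u); clear; lia.
  subst u; have [xV xv _ xd] := Hs x xs.
  have := @live_drop l v true rl vV vP tv rq z [:: x] isT uV.
  have H : {in [:: x], forall z0, [&& z0 \in N z, z0 \notin processed l & dead
    l' z0]}.
    by move=> y; rewrite mem_seq1 => /eqP->; rewrite xu xP.
  move=> /(_ H) /=; have := phi_step rl vV vP tv acc M uV (alive rl tv c6 uV
    zP).
  move: (aanbr l' z && _) (live l' z) (live l z) (phi l M z) (phi l' M z).
  by rewrite !mul0n !add0n; clear; lia.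
rewrite big_split /= leq_add2l /g !big_split /= exchange_big /=.
have -> : \sum_(u <- V) (u == v) * 7 = 7.
  by rewrite (sum_indicator _ (fun=> 7)) ?fset_uniq // vV.
have -> : \sum_(u <- V) (b && (u == z)) = b :> nat.
  case: (boolP b) => [/Hb[zV _ _ _ _]|_] /=; last by rewrite big1.
  under eq_bigr => u _ do rewrite -[nat_of_bool _]muln1.
  by rewrite (sum_indicator _ (fun=> 1)) ?fset_uniq // zV.
have swap (w : seq nat) (f : nat -> nat) : {subset w <= V} ->
    \sum_(n <- w) \sum_(u <- V) (n == u) * f n = \sum_(n <- w) f n.
  move=> wV; rewrite big_seq [RHS]big_seq; apply: eq_bigr => n nw.
  under eq_bigr => u _ do rewrite eq_sym.
  by rewrite (sum_indicator _ (fun=> f n)) ?fset_uniq // (wV n nw) mul1n.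
rewrite (swap (N v)) => [|n /nbrV //].
rewrite [\sum_(j <- V) \sum_(x <- s) _]exchange_big /= swap => [|x /Hs[]//].
suff : 4 * n_act l v + 6 * n_ord l v + 3 * n_free l v <= \sum_(n <- N v) gn n.
  set S1 := \sum_(n <- N v) gn n; set S2 := \sum_(x <- s) _.
  by clearbody S1 S2; clear; lia.
apply: (@sum_nbr l v gn 4 6 3) => n nv; rewrite /gn.
by case: (nbr_specP rl vV vP tv rq mM nv) => _ d; rewrite d.
Qed.

End AcceptGain.

(** * How a requesting vertex can meet active vertices *)

Section RequestNeighbors.

Variables (l : log) (v : nat).
Hypotheses (rl : run G l) (vV : v \in V) (vP : v \notin processed l).
Hypothesis tv : top G l v.
Hypothesis rq : requests_advice l (vitem G v).

Let c6 := rq_class6 vV rq.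

(* This is what P6 excludes. *)
Lemma share1 (e : entry) u1 u2 : e \in l -> aa e -> u1 != u2 -> u1 \in N v ->
  u2 \in N v ->
  u1 \in N (vname e) -> u2 \in N (vname e) -> False.
Proof.
move=> el ea u12 u1v u2v u1e u2e.
have C : 2 <= common (vitem G v) e.
  rewrite /common (nbhE rl el) /= -[2]/((true : bool).+1) -u12 -cardfs2.
  by apply: fsubset_leq_card; apply/fsubsetP => z; rewrite in_fset2 in_fsetI =>
    /orP[]/eqP->; rewrite ?u1v ?u2v ?u1e ?u2e.
have nb : ~~ bad e.
  apply/negP => be; have := bad_nbr rl el be u1e (rq_nbrP vV rq u1v).
  by case: (deg_cases rl tv c6 (nbrV u1v) (rq_nbrP vV rq u1v)) => ->.
move: rq; rewrite /requests_advice; case: (vclassP l vV) => // _ _.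
  by move=> /hasPn/(_ e el); rewrite ea nb C.
move=> /hasPn/(_ e el); by have /andP[-> _] := ea; rewrite (ltnW C).
Qed.

Lemma class8_noact : vclass l (vitem G v) = 8 -> n_act l v = 0.
Proof.
move=> c8; apply/eqP; rewrite -leqn0 leqNgt -has_count; apply/hasPn => n nv.
apply/negP => /(aanbrP _ rl)[e [el ea ne]].
move: c8; case: (vclassP l vV) => // _ _ /hasPn/(_ e el) + _.
have /andP[-> _] := ea; rewrite /common (nbhE rl el) /= cardfs_gt0 negbK =>
  /eqP E.
by have : n \in N v `&` N (vname e); [rewrite in_fsetI nv | rewrite E in_fset0].
Qed.

(** The a-vertex that shares a neighbor with [v] was accepted; otherwise the shared neighbor would
    be forced. *)
Lemma class7_act : vclass l (vitem G v) = 7 -> 1 <= n_act l v.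
Proof.
case: (vclassP l vV) => // _ _ _ /hasP[e el /andP[de]].
rewrite /common cardfs_gt0 => /fset0Pn[u]; rewrite in_fsetI => /andP[uv ue] _.
rewrite -has_count; apply/hasP; exists u => //.
apply/hasP; exists e => //; rewrite /aa de ue andbT; apply/negPn/negP => ne.
have : forced l u by apply/forcedP; exists e => //; rewrite ne andbT nbrC
  -(nbhE rl el).
by rewrite (negPf (unforced_settled rl tv c6 (nbrV uv) (rq_nbrP vV rq uv))).
Qed.

(** In a settled state, an accepted neighbor of [e] would make [u] a doomed sibling. So the
    processed neighbors of [e] are rejected, and if [u] were its only unprocessed neighbor, [e]
    would be contributing. *)
Lemma noncontributing (e : entry) u : e \in l -> aa e -> u \in N (vname e) ->
  u \notin processed l -> ~~ contributing l e ->
  exists s, [/\ s \in N (vname e), s != u & s \notin processed l].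
Proof.
move=> el ea ue uP nc; have uV := nbrV ue.
suff : 2 <= count [pred y | y \notin processed l] (N (vname e)).
  case/(count2P (uniq_nbr _)) => x [y [xy xe ye xP yP]].
  case: (eqVneq x u) => xu; last by exists x.
  by exists y; split=> //; rewrite -xu eq_sym.
rewrite ltnNge; apply/negP => c2; case/negP: nc.
have cr : count [pred y | y \in rejected l] (N (vname e))
          = count [predC [pred y | y \notin processed l]] (N (vname e)).
  apply: eq_in_count => y ye; rewrite /= negbK; apply/idP/idP.
    by case/mapP=> e0; rewrite mem_filter => /andP[_ ?] ->; apply: map_f.
  move=> yP; case/orP: (processed_split yP) => // yA.
  have yu : y != u by apply: contra uP => /eqP<-.
  have : dead l u.
    apply/sibling_dead/hasP; exists e => //; rewrite ea (nbhE rl el) ue /=.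
    by apply/hasP; exists y; rewrite // yu yA.
  by rewrite (settledE rl tv c6 uV) (negPf uP).
have c1 : 1 <= count [pred y | y \notin processed l] (N (vname e)).
  by rewrite -has_count; apply/hasP; exists u.
have := count_predC [pred y | y \notin processed l] (N (vname e)).
rewrite (aa_size rl el ea) -cr => S.
rewrite /contributing ea /current_neighborhood !card_fset_sep (nbhE rl el).
have -> : it e = vitem G (vname e) by have [] := run_wf rl el.
apply/andP; split; apply/eqP; move: c1 c2 S; set p := count _ _;
  set q := count _ _;
 clearbody p q; clear; lia.
Qed.

Variable M : pred nat.
Hypothesis mM : marking l M.

Lemma rq_act n : n \in N v -> aanbr l n -> act l M n.
Proof. by move=> nv; case: (nbr_specP rl vV vP tv rq mM nv). Qed.

Lemma nbr_other n : n \in N v -> deg l n = 2 -> exists x,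
  [/\ x \in N n, x \notin processed l, x != v, x \notin N v &
      {in N n, forall y, y \notin processed l -> (y == v) || (y == x)}].
Proof.
move=> nv d2; have vn : v \in N n by rewrite nbrC.
have [x [xn xv xP Hx]] := other_nbr d2 vn vP; exists x; split=> //.
by apply/negP => xNv; apply: (no_triangle xNv nv xn).
Qed.

Lemma other_unmarked n x : n \in N v -> aanbr l n -> x \in N n ->
  x \notin processed l -> M x = false.
Proof.
move=> nv an xn xP; apply/negP => xM; have nP := rq_nbrP vV rq nv.
have nx : n \in N x by rewrite nbrC.
have := marked_nbr mM xM xP nx nP; rewrite (rq_nbrM vV vP rq mM nv) an orbF /=.
by case: (deg_cases rl tv c6 (nbrV nv) nP) => ->.
Qed.

Lemma other_phi n x : n \in N v -> aanbr l n -> x \in N n ->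
  x \notin processed l ->
  phi l M x = if aanbr l x then 3 else 3 - deg l x.
Proof.
move=> nv an xn xP; have xV := nbrV xn.
rewrite (phi_settled rl tv c6) // (other_unmarked nv an xn xP).
case: (boolP (aanbr l x)) => ax; last by rewrite !addn0.
have := aanbr_deg rl xV ax.
by case: (deg_cases rl tv c6 xV xP) => ->.
Qed.

Lemma sibling_out (e : entry) n s : n \in N v -> e \in l -> aa e ->
  n \in N (vname e) -> s \in N (vname e) -> s != n ->
  s != v /\ s \notin N v.
Proof.
move=> nv el ea ne se sn; split.
  apply/eqP => sv; subst s; have ev : vname e \in N v by rewrite nbrC.
  by have := rq_nbrP vV rq ev; rewrite map_f.
by apply/negP => sv; apply: (share1 el ea sn).
Qed.

(** Each of the two aa-vertices shares at most one neighbor with [v], by [share1], and together they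
    see all active vertices. *)
Lemma pairs_act e1 e2 : two_pairs l M e1 e2 -> n_act l v <= 2.
Proof.
case=> [[el1 el2 ea1 ea2] cov _ _]; rewrite leqNgt; apply/negP => n3.
have le : n_act l v <= count [pred n | n \in N (vname e1)] (N v)
                       + count [pred n | n \in N (vname e2)] (N v).
  rewrite -count_predUI; apply: leq_trans (leq_addr _ _).
  apply: count_sub => n nv an; apply: cov; exact: rq_act.
have H (e : entry) : e \in l -> aa e -> count [pred n | n \in N (vname e)] (N
  v) <= 1.
  move=> el ea; rewrite leqNgt; apply/negP => /(count2P (uniq_nbr _)).
  by case=> x [y [xy xv yv xe ye]]; apply: (share1 el ea xy).
by have := H e1 el1 ea1; have := H e2 el2 ea2; move: n3 le; clear; lia.
Qed.

Lemma pairs_sibling e1 e2 n : two_pairs l M e1 e2 -> act l M n ->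
  exists (e : entry) s, [/\ e \in l, aa e, n \in N (vname e), s \in N (vname e)
    &
                s != n /\ act l M s].
Proof.
case=> [[el1 el2 ea1 ea2] cov [p [q [pq p1 q1 pa qa]]] [p' [q' [pq' p2 q2 pa'
  qa']]]].
move=> na; case/orP: (cov n na) => ne.
  case: (eqVneq p n) => pn; [exists e1, q|exists e1, p] => //.
  by split=> //; split=> //; rewrite -pn eq_sym.
case: (eqVneq p' n) => pn; [exists e2, q'|exists e2, p'] => //.
by split=> //; split=> //; rewrite -pn eq_sym.
Qed.

Lemma triple_act e : one_triple l M e -> n_act l v <= 1.
Proof.
case=> [[el ea] _ _ cov]; rewrite leqNgt; apply/negP => /(count2P (uniq_nbr _)).
case=> x [y [xy xv yv ax ay]]; apply: (share1 el ea xy xv yv); apply: cov;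
  exact: rq_act.
Qed.

Lemma triple_siblings (e : entry) n : one_triple l M e -> n \in N (vname e) ->
  two_acts l M e /\ exists p q, [/\ p != q, p \in N (vname e), q \in N (vname
    e),
    p != n & q != n].
Proof.
case=> [[el ea] _ sub _] ne; have s3 := aa_size rl el ea.
have : 2 <= count [pred y | y != n] (N (vname e)).
  have := count_predC [pred y | y == n] (N (vname e)).
  rewrite (count_uniq_mem n (uniq_nbr _)) ne s3.
  have -> : count [predC [pred y | y == n]] (N (vname e)) = count [pred y | y
    != n] (N (vname e)) by [].
  by set c := count _ _; clearbody c; clear; lia.
case/(count2P (uniq_nbr _)) => p [q [pq pe qe pn qn]].
by split; [exists p, q; split=> //; apply: sub|exists p, q].
Qed.

Lemma pending_settled : ~ pending l M.
Proof.
case=> w [_ [_ [_ [_ [[wV wP _ wd] _ _ _ _]]]]].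
by move: wP; rewrite -(settledE rl tv c6) // leaf_dead.
Qed.

End RequestNeighbors.

Section RejectStep.

Variables (l : log) (v : nat).
Hypotheses (rl : run G l) (vV : v \in V) (vP : v \notin processed l).
Hypothesis tv : top G l v.
Hypothesis rq : requests_advice l (vitem G v).

Let c6 := rq_class6 vV rq.

Local Notation e := (Entry (vitem G v) false (requests_advice l (vitem G v))
               (bad_vertex l (vitem G v))).
Local Notation l' := (e :: l).

Lemma reject_run : run G l'.
Proof. by apply: run_step => //; apply: rq_acc. Qed.

Definition extra_reject M y := [/\ y \in V, y \notin processed l, y != v,
  y \notin N v & M y = false /\ dead l' y].

Lemma reject_slack M k k' y (b : bool) : marking l M -> slack l M k ->
  (b -> extra_reject M y) ->
  22 + k <= 7 + 5 * n_act l v + 7 * n_ord l v + 9 * n_free l v + 2 * b + k' ->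
  slack l' M k'.
Proof.
move=> mM; rewrite /slack rq_bits // => H Hb.
have := reject_gain rl vV vP tv rq mM Hb; move: H.
set p := Phi l M; set p' := Phi l' M; set g := 7 + _ + _ + _ + _.
clearbody p p' g; clear; lia.
Qed.

Variable M : pred nat.
Hypothesis mM : marking l M.

(** The rejection of [v] forces [n], which dooms its sibling [s]; by [marked_sib], [s] is unmarked
    because [n] is. *)
Lemma reject_sibling (e0 : entry) n s : n \in N v -> e0 \in l -> aa e0 ->
  n \in N (vname e0) -> s \in N (vname e0) -> s != n -> s \notin processed l ->
  extra_reject M s.
Proof.
move=> nv el ea ne se sn sP.
have [sv sNv] := sibling_out rl vV tv rq nv el ea ne se sn.
have nP := rq_nbrP vV rq nv.
split=> //; first exact: nbrV se.
split.
  apply/negP => sM; have := marked_sib mM el ea se ne sP nP sM.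
  by rewrite (rq_nbrM vV vP rq mM nv).
apply/sibling_dead/hasP; exists e0; first by rewrite in_cons el orbT.
have el' : e0 \in l' by rewrite in_cons el orbT.
rewrite ea (nbhE reject_run el') se andTb; apply/hasP; exists n => //.
rewrite eq_sym sn andTb; apply/orP; right; apply/andP; split; last first.
  exact: reject_forced.
rewrite processed_cons negb_or nP andbT /vname /=.
by apply/eqP => E; rewrite E nbrxx in nv.
Qed.

(** Three active neighbors pay exactly 22, so a slack of 2 needs one more death. If [v] is not bad,
    one of its neighbors hangs on a noncontributing aa-vertex and has an unprocessed sibling. If [v]
    is bad, its rejection dooms the vertices next to its neighbors; this is what P4 is for. *)
Lemma reject_three : n_act l v = 3 -> exists y, extra_reject M y.
Proof.
move=> n3; have all_aa : {in N v, forall n, aanbr l n}.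
  by apply/allP; rewrite all_count -/(n_act l v) n3 (rq_size vV rq).
case: (boolP (bad_vertex l (vitem G v))) => bv; last first.
  move: bv; rewrite /bad_vertex rq /= => /allPn[u uv nc].
  have uP := rq_nbrP vV rq uv.
  have /(aanbrP _ rl)[e0 [el ea ue]] := all_aa u uv.
  have ncon : ~~ contributing l e0.
    apply: contra nc => ce; rewrite /c_neighbor uP; apply/hasP; exists e0 => //.
    by rewrite ce (nbhE rl el).
  have [s [se su sP]] := noncontributing rl vV tv rq el ea ue uP ncon.
  by exists s; apply: (reject_sibling uv el ea ue se su sP).
have [n nv an] : exists2 n, n \in N v & aanbr l n.
  by apply: count1P; rewrite -/(n_act l v) n3.
have d2 : deg l n = 2 by move: an; case: (nbr_specP rl vV vP tv rq mM nv).
have [x [xn xP xv xNv _]] := nbr_other vP nv d2.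
exists x; split=> //; first exact: nbrV xn.
split; first exact: (other_unmarked rl vV vP tv rq mM nv).
apply/near_bad_dead/hasP; exists e; first by rewrite in_cons eqxx.
by rewrite bv /=; apply/hasP; exists n; rewrite // nbrC.
Qed.

End RejectStep.

(** P8 is reached only when no unprocessed vertex of current degree 3 shares a neighbor with an
    a-vertex, which is the degree condition for marking. *)
Lemma class8_marking l v M : run G l -> top G l v ->
  vclass l (vitem G v) = 8 -> marking l M -> marking l (mark l M).
Proof.
move=> rl tv c mM; apply: marking_mark => // m y mP am ym yP;
  have yV := nbrV ym.
have := tv y yV yP; rewrite c; case: (vclassP l yV) => //; try by move=> ? ->.
move=> _ _ /hasPn H _; move: am => /(aanbrP _ rl)[e0 [el ea me]].
have := H e0 el; have /andP[-> _] := ea.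
rewrite /common (nbhE rl el) /= cardfs_gt0 negbK => /eqP E.
by have : m \in N y `&` N (vname e0); [rewrite in_fsetI me nbrC ym|rewrite E
  in_fset0].
Qed.

(** The shape attached to a slack bounds the number of active neighbors, and for slacks 4 and 6 it
    also supplies a dying sibling. In the worst cases 7 + 10 + 7 = 22 + 2, 7 + 10 + 7 + 2 = 22 + 4
    and 7 + 5 + 14 + 2 = 22 + 6. *)
Lemma reject_bounded l v M : run G l -> v \in V -> v \notin processed l ->
  top G l v ->
  requests_advice l (vitem G v) -> marking l M -> bounded l M ->
  let l' := Entry (vitem G v) false (requests_advice l (vitem G v))
               (bad_vertex l (vitem G v)) :: l in
  exists M', marking l' M' /\ bounded l' M'.
Proof.
move=> rl vV vP tv rq mM bM l'.
have c6 := rq_class6 vV rq; have acc := @rq_acc l v false rq.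
have nt := n_total rl vV vP tv rq mM.
have : (vclass l (vitem G v) == 7) || (vclass l (vitem G v) == 8) by [].
case/orP => /eqP c; last first.
  have mM' := class8_marking rl tv c mM.
  exists (mark l M); split; first exact: marking_step.
  have s0 : slack l (mark l M) 0 := bounded_mark rl tv c6 mM bM.
  apply: Bounded0; apply: (reject_slack rl vV vP tv rq (M:=mark l M) (k:=0)
    (y:=0) (b:=false)) => //.
  by rewrite (class8_noact rl vV c) in nt *; move: nt; clear; lia.
have a1 := class7_act rl vV tv rq c.
exists M; split; first exact: marking_step.
apply: Bounded0.
have gen : slack l M 2 -> slack l' M 0.
  move=> s2; case: (ltnP (n_act l v) 3) => a3.
    apply: (reject_slack rl vV vP tv rq (M:=M) (k:=2) (y:=0) (b:=false)) => //.
    by move: nt a1 a3; clear; lia.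
  have a3' : n_act l v = 3 by move: nt a3; clear; lia.
  have [y Hy] := reject_three rl vV vP tv rq mM a3'.
  apply: (reject_slack rl vV vP tv rq (M:=M) (k:=2) (y:=y) (b:=true)) => //.
  by move: nt a3'; clear; lia.
have [n nv an] := count1P a1.
have na := rq_act rl vV vP tv rq mM nv an.
case: bM => [s0|r _ s2|e1 e2 tp s4|e0 ot s6|pd].
- by apply: gen; apply: leq_trans s0 _; rewrite leq_add2l.
- exact: gen.
- have [e0 [s [el ea ne se [sn sa]]]] := pairs_sibling tp na.
  have [sP _ _] := notdead (proj1 (andP sa)).
  apply: (reject_slack rl vV vP tv rq (M:=M) (k:=4) (y:=s) (b:=true)) => //.
    by move=> _; apply: (reject_sibling rl vV vP tv rq mM nv el ea ne se sn sP).
  by have := pairs_act rl vV vP tv rq mM tp; move: nt a1; clear; lia.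
- have [[el ea] _ sub cov] := ot; have ne := cov n na.
  have [_ [p [_ [_ pe _ pn _]]]] := triple_siblings rl ot ne.
  have [pP _ _] := notdead (proj1 (andP (sub p pe))).
  apply: (reject_slack rl vV vP tv rq (M:=M) (k:=6) (y:=p) (b:=true)) => //.
    by move=> _; apply: (reject_sibling rl vV vP tv rq mM nv el ea ne pe pn pP).
  by have := triple_act rl vV vP tv rq mM ot; move: nt a1; clear; lia.
- by case: (pending_settled rl vV tv rq pd).
Qed.

Section AcceptStep.

Variables (l : log) (v : nat).
Hypotheses (rl : run G l) (vV : v \in V) (vP : v \notin processed l).
Hypothesis tv : top G l v.
Hypothesis rq : requests_advice l (vitem G v).

Let acc := @rq_acc l v true rq.
Let c6 := rq_class6 vV rq.

Local Notation e := (Entry (vitem G v) true (requests_advice l (vitem G v))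
               (bad_vertex l (vitem G v))).
Local Notation l' := (e :: l).

Definition extra_accept (s : seq nat) z (b : bool) :=
  [/\ uniq s,
  (forall x, x \in s -> [/\ x \in V, x != v, x \notin N v & dead l' x]) &
  (b -> [/\ z \in V, z \notin processed l, z != v, z \notin s &
        (z \in N v -> deg l z = 3) /\
        exists2 x, x \in s & (x \in N z) && (x \notin processed l)])].

Lemma accept_slack M k k' s z (b : bool) : marking l M -> slack l M k ->
  extra_accept s z b ->
  22 + k <= 7 + 4 * n_act l v + 6 * n_ord l v + 3 * n_free l v
     + \sum_(x <- s) (7 - phi l M x) + b + k' ->
  slack l' M k'.
Proof.
move=> mM; rewrite /slack rq_bits // => H [us Hs Hb].
have := accept_gain rl vV vP tv rq mM us Hs Hb; move: H.
set p := Phi l M; set p' := Phi l' M; set g := 7 + _ + _ + _ + _ + _.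
clearbody p p' g; clear; lia.
Qed.

Lemma extra_none : extra_accept [::] 0 false. Proof. by []. Qed.

(* The only way to become dead by an acceptance is to be next to a new leaf. *)
Lemma accept_notdead u : u \in V -> u \notin processed l -> u != v ->
  2 <= deg l' u -> {in N v, forall n, deg l n = 2 -> n \notin N u} ->
  ~~ dead l' u.
Proof.
move=> uV uP uv d2 leafless.
have /norP[_ /norP[nf /norP[_ /norP[ns /norP[nb _]]]]] := alive rl tv c6 uV uP.
rewrite /dead; apply/negP => /or4P[||du|].
- by rewrite processed_cons (negPf uP) orbF; apply/negP.
- by rewrite accept_forced; apply/negP.
- by move: d2; rewrite ltnNge du.
apply/negP/norP; split; [|apply/norP; split].
- apply/hasPn => e0; rewrite in_cons => el; apply/negP => /and3P[ea ue /hasP[y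
    ye]].
  case/andP=> yu; case/orP: el => [/eqP E|el].
    have yv : y \in N v by move: ye; rewrite E.
    have yP := rq_nbrP vV rq yv; have yV := nbrV yv.
    case/orP=> [|/andP[_]]; last first.
      by rewrite accept_forced (negPf (unforced_settled rl tv c6 yV yP)).
    rewrite /accepted /= in_cons => /orP[/eqP E'|].
      by move: yv; rewrite E' nbrxx.
    case/mapP=> e1; rewrite mem_filter => /andP[_ e1l] E'.
    by move: yP; rewrite E' map_f.
  rewrite (nbhE rl el) in ye ue; have yV := nbrV ye.
  case/orP=> [|/andP[yP]]; last first.
    move: yP; rewrite processed_cons negb_or => /andP[_ yP].
    by rewrite accept_forced (negPf (unforced_settled rl tv c6 yV yP)).
  rewrite /accepted /= in_cons => /orP[/eqP E'|yA].
    have ev : vname e0 \in N v by rewrite nbrC; move: ye; rewrite E'.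
    by have := rq_nbrP vV rq ev; rewrite map_f.
  case/negP: ns; apply/hasP; exists e0 => //; rewrite ea (nbhE rl el) ue /=.
  by apply/hasP; exists y; rewrite // yu yA.
- by rewrite /near_rejected_bad /= andbF.
- apply/hasPn => w wu; apply/negP => /and3P[]; rewrite processed_cons negb_or.
  move=> /andP[wv wP] _ dw; have wV := nbrV wu.
  case: (boolP (w \in N v)) => wNv; last first.
    rewrite (accept_deg_out vP wNv) in dw.
    by case: (deg_cases rl tv c6 wV wP) dw => ->.
  have dw' := accept_deg vP wNv.
  have d2' : deg l w = 2.
    case: (deg_cases rl tv c6 wV wP) => // d; move: dw dw'; rewrite d.
    by case: (deg l' w) => [|[|]].
  by have := leafless w wNv d2'; rewrite wu.
Qed.

Lemma free_act M r : marking l M -> r \in N v -> deg l r = 3 -> act l' M r.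
Proof.
move=> mM rv d; have rP := rq_nbrP vV rq rv; have rV := nbrV rv.
apply/and3P; split.
- apply: accept_notdead => //.
  + by apply/eqP => E; rewrite E nbrxx in rv.
  + by have := accept_deg vP rv; rewrite d => -[->].
  + by move=> n nv _; apply/negP => nr; apply: (no_triangle nv rv nr).
- by rewrite accept_aanbr // rv.
- by rewrite (rq_nbrM vV vP rq mM rv).
Qed.

Lemma near_new_leaf_dead n x : n \in N v -> deg l n = 2 -> n \in N x ->
  dead l' x.
Proof.
move=> nv d nx; apply/near_leaf_dead/hasP; exists n => //.
have nP := rq_nbrP vV rq nv.
rewrite processed_cons negb_or nP andbT accept_forced.
rewrite (unforced_settled rl tv c6 (nbrV nv) nP) /=; apply/andP; split.
  by apply/eqP => E; rewrite /vname /= in E; rewrite E nbrxx in nv.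
by have := accept_deg vP nv; rewrite d => -[->].
Qed.

Variable M : pred nat.
Hypothesis mM : marking l M.

Lemma extra_one n x : n \in N v -> deg l n = 2 -> x \in N n -> x != v ->
  x \notin N v -> extra_accept [:: x] 0 false.
Proof.
move=> nv d xn xv xNv; split=> // y; rewrite mem_seq1 => /eqP->; split=> //.
  exact: (nbrV xn).
by apply: (near_new_leaf_dead nv d); rewrite nbrC.
Qed.

Lemma extra_two n x n' x' : n \in N v -> deg l n = 2 -> x \in N n -> x != v ->
  x \notin N v -> n' \in N v -> deg l n' = 2 -> x' \in N n' -> x' != v ->
  x' \notin N v -> x != x' -> extra_accept [:: x; x'] 0 false.
Proof.
move=> nv d xn xv xNv nv' d' xn' xv' xNv' xx'; split=> //;
  first by rewrite /= inE xx'.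
move=> y; rewrite in_cons mem_seq1 => /orP[]/eqP->; split=> //.
- exact: (nbrV xn).
- by apply: (near_new_leaf_dead nv d); rewrite nbrC.
- exact: (nbrV xn').
- by apply: (near_new_leaf_dead nv' d'); rewrite nbrC.
Qed.

Lemma aanbr_deg2 n : n \in N v -> aanbr l n -> deg l n = 2.
Proof. by move=> nv; case: (nbr_specP rl vV vP tv rq mM nv). Qed.

Lemma unique_leaf w z : n_free l v = 2 -> w \in N v -> deg l w = 2 ->
  z \in N v ->
  z != w -> deg l z = 3.
Proof.
move=> f2 wv dw zv zw.
case: (deg_cases rl tv c6 (nbrV zv) (rq_nbrP vV rq zv)) => // dz.
have := count_predC [pred n | deg l n == 3] (N v); rewrite -/(n_free l v) f2.
have : 2 <= count (predC [pred n | deg l n == 3]) (N v).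
  by apply: (@count_ge2 _ _ _ z w); rewrite ?uniq_nbr //= ?dz ?dw.
rewrite (rq_size vV rq); set c := count _ _; clearbody c; clear; lia.
Qed.

(** The other neighbor [x] of the new leaf dies. If [x] has degree 3 this gains 7 at once. If it has
    degree 2, it gains 4 or 6, and its other neighbor [z] gains 1 for losing it; [w] being the only
    new leaf, [z] can lie in [N v] only as a free vertex. *)
Lemma one_leaf_extra w : w \in N v -> aanbr l w -> n_free l v = 2 ->
  exists x z b, [/\ x \in N w /\ x \notin processed l,
    {in N w, forall y, y \notin processed l -> (y == v) || (y == x)},
    extra_accept [:: x] z b &
    (if aanbr l x then 5 else 7) <= 7 - phi l M x + b].
Proof.
move=> wv aw f2; have dw := aanbr_deg2 wv aw.
have [x [xw xP xv xNv xuniq]] := nbr_other vP wv dw.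
have xV := nbrV xw; have wP := rq_nbrP vV rq wv.
have px := other_phi rl vV vP tv rq mM wv aw xw xP.
have [us Hs _] := extra_one wv dw xw xv xNv.
case: (deg_cases rl tv c6 xV xP) => dx; last first.
  exists x, 0, false; split=> //.
  have nax : aanbr l x = false by apply/negP => /(aanbr_deg rl xV); rewrite dx.
  by rewrite px nax dx.
have wx : w \in N x by rewrite nbrC.
have [z [zx zw zP _]] := other_nbr dx wx wP.
exists x, z, true; split=> //; last by rewrite px dx; case: (aanbr l x).
split=> // _; split=> //.
- exact: (nbrV zx).
- by apply/eqP => E; move: xNv; rewrite nbrC -E zx.
- by rewrite mem_seq1; apply/eqP => E; rewrite E nbrxx in zx.
split; first by move=> zv; apply: (unique_leaf f2 wv dw).
by exists x; rewrite ?mem_head // nbrC zx xP.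
Qed.

Lemma act_extra w : w \in N v -> aanbr l w ->
  exists x, [/\ x \in N w, x \notin processed l, extra_accept [:: x] 0 false &
    (if aanbr l x then 4 else 6) <= 7 - phi l M x].
Proof.
move=> wv aw; have dw := aanbr_deg2 wv aw.
have [x [xw xP xv xNv _]] := nbr_other vP wv dw.
have px := other_phi rl vV vP tv rq mM wv aw xw xP.
exists x; split=> //; first exact: (extra_one wv dw).
rewrite px; case: (aanbr l x) => //.
by case: (deg_cases rl tv c6 (nbrV xw) xP) => ->.
Qed.

(** If the other neighbor [x] of [n] has degree 2, it is not adjacent to all three neighbors of [v];
    so a second vertex [x'] dies as well. *)
Lemma three_extra : n_act l v = 3 ->
  exists s, extra_accept s 0 false /\ 5 <= \sum_(x <- s) (7 - phi l M x).
Proof.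
move=> a3; have all_aa : {in N v, forall n, aanbr l n}.
  by apply/allP; rewrite all_count -/(n_act l v) a3 (rq_size vV rq).
have [n nv an] : exists2 n, n \in N v & aanbr l n.
  by apply: count1P; rewrite -/(n_act l v) a3.
have dn := aanbr_deg2 nv an.
have [x [xn xP xv xNv _]] := nbr_other vP nv dn.
have xV := nbrV xn.
have px := other_phi rl vV vP tv rq mM nv an xn xP.
case: (deg_cases rl tv c6 xV xP) => dx; last first.
  exists [:: x]; split; first exact: (extra_one nv dn).
  have nax : aanbr l x = false by apply/negP => /(aanbr_deg rl xV); rewrite dx.
  by rewrite big_seq1 px nax dx.
have [n' n'v n'x] : exists2 n', n' \in N v & n' \notin N x.
  apply/allPn; apply/negP => /allP sub.
  have : size (N v) <= deg l x.
    rewrite /deg -size_filter; apply: uniq_leq_size; first exact: uniq_nbr.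
    by move=> y yv; rewrite mem_filter /= (rq_nbrP vV rq yv) sub.
  by rewrite (rq_size vV rq) dx.
have an' := all_aa n' n'v; have dn' := aanbr_deg2 n'v an'.
have [x' [xn' xP' xv' xNv' _]] := nbr_other vP n'v dn'.
have px' := other_phi rl vV vP tv rq mM n'v an' xn' xP'.
exists [:: x; x']; split.
  apply: (extra_two nv dn xn xv xNv n'v dn') => //.
  by apply/eqP => E; move: n'x; rewrite nbrC E xn'.
rewrite big_cons big_seq1 px px' dx.
case: (aanbr l x); case: (aanbr l x') => //.
all: by case: (deg_cases rl tv c6 (nbrV xn') xP') => ->.
Qed.

(** A free neighbor becomes active and carries the slack of 2; without free neighbors the gain
    repays it. *)
Lemma gen_bounded : slack l M 2 -> 1 <= n_act l v -> bounded l' M.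
Proof.
move=> s2 a1; have nt := n_total rl vV vP tv rq mM.
have [w wv aw] := count1P a1.
case: (posnP (n_free l v)) => f0.
  apply: Bounded0.
  case: (ltnP (n_act l v) 3) => a3; last first.
    have [s [Hs gs]] : exists s, extra_accept s 0 false /\ 5 <= \sum_(x <- s)
      (7 - phi l M x).
      by apply: three_extra; move: nt a3; clear; lia.
    apply: (accept_slack mM s2 Hs).
    by move: nt a3 f0 gs; set S := \sum_(x <- s) _; clearbody S; clear; lia.
  have [x [_ _ Hx gx]] := act_extra wv aw.
  apply: (accept_slack mM s2 Hx); rewrite big_seq1.
  have : 4 <= 7 - phi l M x by move: gx; case: (aanbr l x); clear; lia.
  by move: nt a1 a3 f0; clear; lia.
have [r rv /eqP dr] := count1P f0.
apply: (@Bounded2 _ _ r); first exact: free_act.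
case: (eqVneq (n_free l v) 2) => f2.
  have [x [z [b [_ _ Hx gx]]]] := one_leaf_extra wv aw f2.
  apply: (accept_slack mM s2 Hx); rewrite big_seq1.
  have : 5 <= 7 - phi l M x + b by move: gx; case: (aanbr l x); clear; lia.
  by move: nt a1 f2; clear; lia.
have [x [_ _ Hx gx]] := act_extra wv aw.
apply: (accept_slack mM s2 Hx); rewrite big_seq1.
have : 4 <= 7 - phi l M x by move: gx; case: (aanbr l x); clear; lia.
by move: nt a1 f2 f0; clear; lia.
Qed.

Lemma accept_old_act u : act l' M u -> (u \in N v) || act l M u.
Proof.
case/and3P=> du; rewrite accept_aanbr //.
case: (boolP (u \in N v)) => //= _ au mu; have uV : u \in V.
  by move/(aanbrP _ rl): au => [e0 [_ _ /nbrV]].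
by rewrite /act au mu !andbT; apply: contra du; apply: dead_mono.
Qed.

(** With two free neighbors the acceptance creates [w] as its only leaf, and only vertices next to a
    new leaf die unexpectedly. *)
Lemma act_persist w s : n_free l v = 2 -> w \in N v -> deg l w = 2 ->
  act l M s -> s != w -> s \notin N w -> act l' M s.
Proof.
move=> f2 wv dw sa sw snw; have sV := act_V rl sa.
have /and3P[/notdead[sP _ ds] aas ms] := sa.
have ds2 := aanbr_deg rl sV aas.
have sNv : s \notin N v.
  by apply/negP => sv; move: ds2; rewrite (unique_leaf f2 wv dw sv sw).
apply/and3P; split=> //; last by rewrite accept_aanbr // aas orbT.
apply: accept_notdead => //.
- by apply/eqP => E; move: ds2; rewrite E (rq_deg vV rq).
- by rewrite (accept_deg_out vP sNv).
move=> n nv dn; case: (eqVneq n w) => [->|nw]; first by rewrite nbrC.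
by move: dn; rewrite (unique_leaf f2 wv dw nv nw).
Qed.

Lemma two_free_acts : n_free l v = 2 -> two_acts l' M e.
Proof.
move=> f2; have : 2 <= n_free l v by rewrite f2.
case/(count2P (uniq_nbr _)) => p [q [pq pv qv /eqP dp /eqP dq]].
by exists p, q; split=> //; apply: free_act.
Qed.

Lemma accept_aa : aa e. Proof. by rewrite /aa /= rq. Qed.

(** The critical case is [x1 = x2] active. Then [x1] is next to one of the two aa-vertices, and by
    triangle-freeness neither [w1] nor [w2] is next to that one. Both are next to the other, which
    contradicts [share1]. *)
Lemma pairs_two_extra e1 e2 : two_pairs l M e1 e2 -> n_act l v = 2 ->
  exists s, extra_accept s 0 false /\ 6 <= \sum_(x <- s) (7 - phi l M x).
Proof.
move=> tp a2; have : 2 <= n_act l v by rewrite a2.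
case/(count2P (uniq_nbr _)) => w1 [w2 [w12 w1v w2v aw1 aw2]].
have d1 := aanbr_deg2 w1v aw1; have d2 := aanbr_deg2 w2v aw2.
have [x1 [x1w x1P x1v x1Nv _]] := nbr_other vP w1v d1.
have [x2 [x2w x2P x2v x2Nv _]] := nbr_other vP w2v d2.
have px1 := other_phi rl vV vP tv rq mM w1v aw1 x1w x1P.
have px2 := other_phi rl vV vP tv rq mM w2v aw2 x2w x2P.
have c x : x \in V -> x \notin processed l -> 3 - deg l x <= 1.
  by move=> xV xP; case: (deg_cases rl tv c6 xV xP) => ->.
have c1 := c x1 (nbrV x1w) x1P; have c2 := c x2 (nbrV x2w) x2P.
case: (eqVneq x1 x2) => x12; last first.
  exists [:: x1; x2]; split; first exact: (extra_two w1v d1 _ _ _ w2v d2).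
  rewrite big_cons big_seq1 px1 px2.
  by case: (aanbr l x1); case: (aanbr l x2); move: c1 c2; clear; lia.
exists [:: x1]; split; first exact: (extra_one w1v d1).
rewrite big_seq1 px1; case: (boolP (aanbr l x1)) => ax1; last by move: c1;
  clear; lia.
have [[el1 el2 ea1 ea2] cov _ _] := tp.
have ax : act l M x1.
  rewrite /act ax1 (other_unmarked rl vV vP tv rq mM w1v aw1 x1w x1P) andbT.
  exact: (alive rl tv c6 (nbrV x1w) x1P).
have cw1 := cov w1 (rq_act rl vV vP tv rq mM w1v aw1).
have cw2 := cov w2 (rq_act rl vV vP tv rq mM w2v aw2).
have x1w2 : x1 \in N w2 by rewrite x12.
have key (e0 e0' : entry) : e0 \in l -> e0' \in l -> aa e0 -> aa e0' ->
  x1 \in N (vname e0) ->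
    (w1 \in N (vname e0)) || (w1 \in N (vname e0')) ->
    (w2 \in N (vname e0)) || (w2 \in N (vname e0')) -> False.
  move=> el el' ea ea' xe /orP[w1e|w1e]; first by case: (no_triangle xe w1e
    x1w).
  move=> /orP[w2e|w2e]; first by case: (no_triangle xe w2e x1w2).
  exact: (share1 rl vV tv rq el' ea' w12 w1v w2v w1e w2e).
case/orP: (cov x1 ax) => xe; first by case: (key e1 e2).
by case: (key e2 e1) => //; rewrite orbC.
Qed.

Lemma pairs_bounded e1 e2 : two_pairs l M e1 e2 -> slack l M 4 ->
  1 <= n_act l v -> bounded l' M.
Proof.
move=> tp s4 a1; have nt := n_total rl vV vP tv rq mM.
have a2 := pairs_act rl vV vP tv rq mM tp.
have [w wv aw] := count1P a1; have dw := aanbr_deg2 wv aw.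
have [x1 [_ _ Hx1 gx1]] := act_extra wv aw.
have {}gx1 : 4 <= 7 - phi l M x1 by move: gx1; case: (aanbr l x1); clear; lia.
case: (posnP (n_free l v)) => f0.
  apply: Bounded0; case: (eqVneq (n_act l v) 2) => a2'.
    have [s [Hs gs]] := pairs_two_extra tp a2'.
    apply: (accept_slack mM s4 Hs).
    by move: nt a2' f0 gs; set S := \sum_(x <- s) _; clearbody S; clear; lia.
  apply: (accept_slack mM s4 Hx1); rewrite big_seq1.
  by move: nt a1 a2 a2' f0 gx1; clear; lia.
have [r rv /eqP dr] := count1P f0.
have ra := free_act mM rv dr.
case: (eqVneq (n_free l v) 2) => f2; last first.
  apply: (@Bounded2 _ _ r ra); case: (eqVneq (n_act l v) 2) => a2'.
    have [s [Hs gs]] := pairs_two_extra tp a2'.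
    apply: (accept_slack mM s4 Hs).
    by move: nt a2' f0 f2 gs; set S := \sum_(x <- s) _; clearbody S; clear; lia.
  apply: (accept_slack mM s4 Hx1); rewrite big_seq1.
  by move: nt a1 a2 a2' f0 f2 gx1; clear; lia.
have [x [z [b [[xw xP] xuniq Hx gx]]]] := one_leaf_extra wv aw f2.
move: gx; case: (boolP (aanbr l x)) => ax gx; last first.
  apply: (@Bounded2 _ _ r ra); apply: (accept_slack mM s4 Hx); rewrite big_seq1.
  by move: nt a1 f2 gx; clear; lia.
(* If [x] is active, the gain is only 7 + 4 + 6 + 5 = 22. The missing 2 come with the rejection of
   the leaf [w], since [x] has an active sibling. *)
apply: BoundedP; last first.
  apply: (accept_slack mM s4 Hx); rewrite big_seq1.
  by move: nt a1 f2 gx; clear; lia.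
have xa : act l M x.
  rewrite /act ax (other_unmarked rl vV vP tv rq mM wv aw xw xP) andbT.
  exact: (alive rl tv c6 (nbrV xw) xP).
have [e0 [s [el ea xe se [sx sa]]]] := pairs_sibling tp xa.
have [_ Hx' _] := Hx; have [_ xv _ _] := Hx' x (mem_head _ _).
have wP := rq_nbrP vV rq wv.
have [sP _ ds] := notdead (proj1 (andP sa)).
have aas : aanbr l s by have /and3P[] := sa.
have ds2 := aanbr_deg rl (act_V rl sa) aas.
have vw : w == v = false by apply/eqP => E; rewrite E nbrxx in wv.
have sw : s != w by apply/eqP => E; apply: (no_triangle xe _ xw); rewrite -E.
have snw : s \notin N w.
  apply/negP => snw; have := xuniq s snw sP; rewrite (negPf sx) orbF => /eqP E.
  by move: ds2; rewrite E (rq_deg vV rq).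
exists w, x, e0, s, r; split.
- split; [exact: nbrV wv| | |].
  + by rewrite processed_cons negb_or wP andbT /vname /= vw.
  + by rewrite accept_forced (unforced_settled rl tv c6 (nbrV wv) wP).
  + by have := accept_deg vP wv; rewrite dw => -[->].
- move=> u uV; rewrite processed_cons negb_or => /andP[uv uP] uw.
  rewrite accept_forced (unforced_settled rl tv c6 uV uP) andbT.
  case: (boolP (u \in N v)) => uNv.
    have := accept_deg vP uNv; rewrite (unique_leaf f2 wv dw uNv uw).
    by move=> -[->].
  rewrite (accept_deg_out vP uNv).
  by case: (deg_cases rl tv c6 uV uP) => ->.
- by split=> //; rewrite processed_cons negb_or xv xP.
- by split=> //; rewrite in_cons el orbT.
split=> //; first exact: (act_persist f2 wv dw).
by apply/eqP => E; move: ds2; rewrite -E dr.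
Qed.

Lemma triple_bounded e0 : one_triple l M e0 -> slack l M 6 ->
  1 <= n_act l v -> bounded l' M.
Proof.
move=> ot s6 a1; have nt := n_total rl vV vP tv rq mM.
have a2 := triple_act rl vV vP tv rq mM ot.
have [w wv aw] := count1P a1; have dw := aanbr_deg2 wv aw.
have [[el ea] _ sub cov] := ot.
have we := cov w (rq_act rl vV vP tv rq mM wv aw).
(* All active vertices lie around [e0], and so does [w]; an active neighbor of [w] would close a
   triangle. *)
have nax x : x \in N w -> x \notin processed l -> aanbr l x = false.
  move=> xw xP; apply/negP => ax.
  have xa : act l M x.
    rewrite /act ax (other_unmarked rl vV vP tv rq mM wv aw xw xP) andbT.
    exact: (alive rl tv c6 (nbrV xw) xP).
  exact: (no_triangle (cov x xa) we xw).
have [x1 [x1w x1P Hx1 gx1]] := act_extra wv aw; rewrite (nax x1) // in gx1.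
case: (posnP (n_free l v)) => f0.
  apply: Bounded0; apply: (accept_slack mM s6 Hx1); rewrite big_seq1.
  by move: nt a1 a2 f0 gx1; clear; lia.
have [r rv /eqP dr] := count1P f0.
have ra := free_act mM rv dr.
case: (eqVneq (n_free l v) 2) => f2; last first.
  apply: (@Bounded2 _ _ r ra); apply: (accept_slack mM s6 Hx1);
    rewrite big_seq1.
  by move: nt a1 a2 f0 f2 gx1; clear; lia.
have [x [z [b [[xw xP] xuniq Hx]]]] := one_leaf_extra wv aw f2;
  rewrite nax // => gx.
apply: (@Bounded4 _ _ e0 e); last first.
  apply: (accept_slack mM s6 Hx); rewrite big_seq1.
  by move: nt a1 f2 gx; clear; lia.
split.
- by split; rewrite ?accept_aa // in_cons ?el ?eqxx ?orbT.
- by move=> u /accept_old_act/orP[->|/cov->]; rewrite ?orbT.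
- have [_ [p [q [pq pe qe pw qw]]]] := triple_siblings rl ot we.
  have out y : y \in N (vname e0) -> y \notin N w.
    by move=> ye; apply/negP => yw; apply: (no_triangle ye we yw).
  by exists p, q; split=> //; apply: (act_persist f2 wv dw); rewrite ?out //;
    apply: sub.
- exact: two_free_acts.
Qed.

(** Here marking has removed all active vertices. Three free neighbors pay 16 and leave the triple
    with slack 6. With an ordinary neighbor the deficit is at most 1: its other neighbor dies and
    weighed at most 5, as in 7 + 6 + 6 + 2 = 21. *)
Lemma fresh_bounded : slack l M 0 -> n_act l v = 0 ->
  (forall u, u \notin processed l -> aanbr l u -> M u) -> bounded l' M.
Proof.
move=> s0 a0 allM; have nt := n_total rl vV vP tv rq mM.
case: (eqVneq (n_free l v) 3) => f3.
  apply: (@Bounded6 _ _ e); last first.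
    apply: (accept_slack mM s0 extra_none); rewrite big_nil f3 a0.
    by clear; lia.
  have all3 : {in N v, forall n, deg l n = 3}.
    have : all [pred n | deg l n == 3] (N v).
      by rewrite all_count -/(n_free l v) f3 (rq_size vV rq).
    by move=> /allP H n /H/eqP.
  split.
  - by rewrite mem_head accept_aa.
  - move=> u uV; apply/idP/idP; last exact: processed_dead.
    rewrite processed_cons; apply: contraTT => /norP[uv uP].
    apply: accept_notdead => //; last by move=> n nv; rewrite all3.
    case: (boolP (u \in N v)) => uNv.
      by have := accept_deg vP uNv; rewrite all3 // => -[->].
    rewrite (accept_deg_out vP uNv).
    by case: (deg_cases rl tv c6 uV uP) => ->.
  - by move=> u uv; apply: free_act => //; apply: all3.
  - move=> u ua; case/orP: (accept_old_act ua) => // /and3P[/notdead[uP _ _] au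
      mu].
    by rewrite (allM u uP au) in mu.
case: (posnP (n_free l v)) => f0.
  apply: Bounded0; apply: (accept_slack mM s0 extra_none); rewrite big_nil.
  by move: nt a0 f0; clear; lia.
have [r rv /eqP dr] := count1P f0.
apply: (@Bounded2 _ _ r (free_act mM rv dr)).
have b1 : 1 <= n_ord l v by move: nt a0 f3; clear; lia.
have [o ov /andP[/eqP d0 _]] := count1P b1.
have [x [xo xP xv xNv _]] := nbr_other vP ov d0.
apply: (accept_slack mM s0 (extra_one ov d0 xo xv xNv)); rewrite big_seq1.
have : phi l M x <= 5.
  have xV := nbrV xo; rewrite (phi_settled rl tv c6) //.
  case: (deg_cases rl tv c6 xV xP) => ->.
    by case: (aanbr l x); case: (M x).
  by case: (aanbr l x); case: (M x).
by move: nt a0 f3 f0; clear; lia.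
Qed.

End AcceptStep.

Lemma accept_bounded l v M : run G l -> v \in V -> v \notin processed l ->
  top G l v ->
  requests_advice l (vitem G v) -> marking l M -> bounded l M ->
  let l' := Entry (vitem G v) true (requests_advice l (vitem G v))
               (bad_vertex l (vitem G v)) :: l in
  exists M', marking l' M' /\ bounded l' M'.
Proof.
move=> rl vV vP tv rq mM bM l'.
have c6 := rq_class6 vV rq; have acc := @rq_acc l v true rq.
have : (vclass l (vitem G v) == 7) || (vclass l (vitem G v) == 8) by [].
case/orP => /eqP c; last first.
  have mM' := class8_marking rl tv c mM.
  exists (mark l M); split; first exact: marking_step.
  apply: fresh_bounded => //.
  - exact: (bounded_mark rl tv c6 mM bM).
  - exact: (class8_noact rl vV c).
  - by move=> u uP au; rewrite /mark uP au.
exists M; split; first exact: marking_step.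
have a1 := class7_act rl vV tv rq c.
case: bM => [s0|r _ s2|e1 e2 tp s4|e0 ot s6|pd].
- by apply: gen_bounded => //; apply: leq_trans s0 _; rewrite leq_add2l.
- exact: gen_bounded.
- exact: (pairs_bounded rl vV vP tv rq mM tp).
- exact: (triple_bounded rl vV vP tv rq mM ot).
- by case: (pending_settled rl vV tv rq pd).
Qed.

Lemma step_bounded e l : run G (e :: l) ->
  (exists M, marking l M /\ bounded l M) ->
  exists M, marking (e :: l) M /\ bounded (e :: l) M.
Proof.
move=> r [M [mM bM]]; inversion r as [|? v a rl vV vP tv acc]; subst.
have [rq|rq] : requests_advice l (vitem G v) \/ ~~ requests_advice l (vitem G
  v).
  by case: (requests_advice _ _); [left|right].
  have := accept_bounded rl vV vP tv rq mM bM.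
  have := reject_bounded rl vV vP tv rq mM bM.
  by case: (a).
case: (leqP (vclass l (vitem G v)) 5) => c.
  exists M; split; first exact: marking_step.
  exact: low_bounded.
have : (vclass l (vitem G v) == 6) || (vclass l (vitem G v) == 9).
  by move: rq c; rewrite /requests_advice; case: (vclassP l vV).
case/orP=> /eqP c'; last exact: (class9_bounded rl vV vP tv acc _ c' mM bM).
exists M; split; first exact: marking_step.
exact: class6_bounded.
Qed.

Theorem run_bounded l : run G l -> exists M, marking l M /\ bounded l M.
Proof.
elim=> [|{}l v a rl IH vV vP tv acc]; last first.
  by apply: step_bounded => //; exact: run_cons.
exists pred0; split; first by split.
by apply: Bounded0; rewrite /slack muln0.
Qed.

(** Every positive slack needs an unprocessed vertex as a witness, so none is left at the end. *)
Theorem run_bits l : run G l -> {subset V <= processed l} ->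
  22 * bits l <= 7 * #|` V|.
Proof.
move=> rl all; have [M [mM bM]] := run_bounded rl.
have noact u : ~ act l M u.
  by move=> ua; have [uP _ _] := notdead (proj1 (andP ua));
    rewrite all ?(act_V rl ua) in uP.
have : slack l M 0.
  case: bM => [//|r /noact//|e1 e2 [_ _ [p [_ [_ _ _ /noact//]]] _]|e [[el ea]
    _ sub _]|].
    have /fset0Pn[u ue] : N (vname e) != fset0.
      by rewrite -cardfs_gt0 (aa_size rl el ea).
    by case: (noact u); apply: sub.
  by case=> w [_ [_ [_ [_ [[wV wP _ _] _ _ _ _]]]]]; rewrite all in wP.
rewrite /slack addn0 => H; apply: leq_trans H _; rewrite /Phi.
apply: (@leq_trans (\sum_(u <- V) 7)); last by rewrite big_const_seq
  iter_addn_0 count_predT.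
by apply: leq_sum => u _; exact: phi_le7.
Qed.

(** * Optimality *)

Lemma oracle_run_run h : oracle_run G h -> run G (log_of h).
Proof. by elim=> [|{}h v a _ IH vV vP tv acc _]; [constructor|apply: run_cons].
  Qed.

Lemma log_of_mem h (e : entry) : e \in log_of h -> (it e, acc e) \in h.
Proof.
elim: h => //= -[x d] h IH; rewrite in_cons => /orP[/eqP->|/IH H] /=.
  exact: mem_head.
by rewrite in_cons H orbT.
Qed.

Lemma processed_log_of h : processed (log_of h) = [seq p.1.1 | p <- h].
Proof. by elim: h => //= -[x d] h IH; rewrite /processed /= -IH. Qed.

Definition optimal_extension (h : history) (S : {fset nat}) :=
  minimum_vertex_cover G S /\
  forall p, p \in h -> (p.1.1 \in S) = p.2.

Lemma opt_agree h S (e : entry) : optimal_extension h S -> e \in log_of h ->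
  (vname e \in S) = acc e.
Proof. by move=> [_ H] /log_of_mem/H. Qed.

Lemma mvc_exists : exists S, minimum_vertex_cover G S.
Proof.
have VC : vertex_cover G V.
  split; first exact: fsubset_refl.
  by move=> u v uv; rewrite (adj_vertices uv).
have [n] : exists n, #|` V| <= n by exists #|` V|.
elim: n V VC => [|n IH] S SC Sn.
  exists S; split=> // T _; apply: leq_trans Sn _; exact: leq0n.
have [[T [TC TS]]|noT] := EM (exists T, vertex_cover G T /\ #|` T| < #|` S|).
  by apply: (IH T) => //; rewrite -ltnS; apply: leq_trans TS Sn.
exists S; split=> // T TC; rewrite leqNgt; apply/negP => TS; apply: noT.
by exists T.
Qed.

Lemma mvc_drop S c : minimum_vertex_cover G S -> c \in S ->
  {in N c, forall w, w \in S} -> False.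
Proof.
move=> [[SV SC] Smin] cS H.
suff /Smin : vertex_cover G (S `\ c).
  by rewrite (cardfsD1 c S) cS add1n ltnn.
split; first by apply: fsubset_trans (fsubD1set _ _) SV.
move=> u w uw; rewrite !in_fsetD1; case: (eqVneq u c) => [uc|_].
  subst u; case: (eqVneq w c) => [wc|_]; first by move: uw; rewrite wc adj_irr.
  by rewrite /= H // nbrE.
case: (eqVneq w c) => [wc|_] /=; last exact: SC.
by subst w; rewrite H // nbrE adj_sym.
Qed.

Lemma mvc_swap S c b : minimum_vertex_cover G S -> c \in S -> b \in V ->
  {in N c, forall w, (w == b) || (w \in S)} ->
  minimum_vertex_cover G (b |` (S `\ c)).
Proof.
move=> [[SV SC] Smin] cS bV H.
have Sle : #|` b |` (S `\ c)| <= #|` S|.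
  by rewrite cardfsU1 (cardfsD1 c S) cS leq_add2r; case: (_ \notin _).
split; last by move=> T /Smin; apply: leq_trans.
split.
  rewrite fsubUset fsub1set bV; apply: fsubset_trans SV; exact: fsubD1set.
move=> u w uw; rewrite !in_fsetU !in_fset1 !in_fsetD1.
have Hc z : adj G c z -> [|| z == b | (z != c) && (z \in S)].
  move=> cz; have /orP[->//|zS] : (z == b) || (z \in S) by apply: H;
    rewrite nbrE.
  rewrite zS andbT orbC; case: eqVneq => // E.
  by move: cz; rewrite E adj_irr.
case: (eqVneq u c) => [uc|uc]; first by subst u; rewrite (Hc w uw) orbT.
case: (eqVneq w c) => [wc|wc].
  by subst w; move: uw; rewrite adj_sym => /Hc; rewrite uc => ->.
by have /orP[->|->] := SC u w uw; rewrite ?orbT.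
Qed.

Lemma swap_agree h S c b : optimal_extension h S ->
  c \notin processed (log_of h) -> b \notin processed (log_of h) ->
  minimum_vertex_cover G (b |` (S `\ c)) -> optimal_extension h (b |` (S `\ c)).
Proof.
move=> [_ H] cP bP mv; split=> // p ph; rewrite -(H p ph).
have pP : p.1.1 \in processed (log_of h) by rewrite processed_log_of;
  apply: (map_f (fun q : item * bool => q.1.1)).
rewrite in_fsetU in_fset1 in_fsetD1.
case: eqVneq => [E|_]; first by rewrite -E pP in bP.
by case: eqVneq => [E|//]; rewrite -E pP in cP.
Qed.

Lemma correctP h v d S : optimal_extension h S -> (v \in S) = d ->
  correct G h (vitem G v) d.
Proof.
move=> [mv H] vd; exists S; split=> // p; rewrite in_cons => /orP[/eqP->|/H //].
exact: vd.
Qed.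

(** Goes back to the history [h2] in which [e] requested advice: for a vertex that is not bad, the
    oracle prefers rejection, so the advice to accept means that rejecting was incorrect. *)
Lemma oracle_accept h (e : entry) : oracle_run G h -> e \in log_of h -> aa e ->
  ~~ bad e -> exists h2, [/\ {subset h2 <= h}, vname e \notin processed (log_of
    h2),
    {in N (vname e), forall z, z \notin processed (log_of h2)} &
    ~ correct G h2 (vitem G (vname e)) false].
Proof.
move=> r; elim: r e => // {}h v a r IH vV vP tv acc_v orc e.
rewrite /= in_cons => /orP[/eqP el|el ea eb]; last first.
  have [h2 [sub ? ? ?]] := IH e el ea eb; exists h2; split=> // p /sub ph.
  by rewrite in_cons ph orbT.
rewrite {}el /aa /vname /= => /andP[rq at_] nb; exists h; split=> //.
- by move=> p ph; rewrite in_cons ph orbT.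
- by have [_] := deg3P vV (rq_deg vV rq).
move=> cf; have [or1 or2] := orc rq.
have [ct|nct] := EM (correct G h (vitem G v) true).
  by have := or2 ct cf; rewrite at_ (negPf nb).
by have := or1 false cf nct; rewrite at_.
Qed.

(** Dual to [oracle_accept]: for a bad-vertex the oracle prefers acceptance. *)
Lemma oracle_reject h (b : entry) : oracle_run G h -> b \in log_of h -> bad b ->
  ~~ acc b -> exists h2, [/\ {subset h2 <= h}, {subset log_of h2 <= log_of h},
    vname b \notin processed (log_of h2),
    {in N (vname b), forall z, c_neighbor (log_of h2) z} &
    ~ correct G h2 (vitem G (vname b)) true].
Proof.
move=> r; elim: r b => // {}h v a r IH vV vP tv acc_v orc b.
rewrite /= in_cons => /orP[/eqP el|el bb ba]; last first.
  have [h2 [sub sub' ? ? ?]] := IH b el bb ba; exists h2; split=> // p.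
    by move=> /sub ph; rewrite in_cons ph orbT.
  by move=> /sub' ph; rewrite in_cons ph orbT.
rewrite {}el /vname /= => bb af; exists h; split=> //.
- by move=> p ph; rewrite in_cons ph orbT.
- by move=> p ph; rewrite in_cons ph orbT.
- by have /andP[_ /allP] := bb.
move=> ct; have [or1 or2] := orc (proj1 (andP bb)).
have [cf|ncf] := EM (correct G h (vitem G v) false).
  by have := or2 ct cf; rewrite bb => E; rewrite E in af.
by have := or1 true ct ncf => E; rewrite E in af.
Qed.

Section Extension.

Variables (h : history) (S : {fset nat}).
Hypotheses (r : oracle_run G h) (oS : optimal_extension h S).

Local Notation l := (log_of h).

Lemma processed_accepted u w : ~~ forced l u -> w \in N u ->
  w \in processed l ->
  w \in S.
Proof.
move=> nf wu /mapP[e el E]; rewrite E (opt_agree oS el).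
by apply/negPn/negP => na; case/negP: nf; apply/forcedP; exists e;
  rewrite // -E wu.
Qed.

Lemma opt_cover u w : w \in N u -> u \notin S -> w \in S.
Proof. by rewrite nbrE => uw uS; have := oS.1.1.2 u w uw;
  rewrite (negPf uS). Qed.

(* If two neighbors of an accepted non-bad vertex [c] were in the cover,
   exchanging [c] for its third neighbor would show that rejecting [c] had been
   correct as well. *)
Lemma aa_two_in (c : entry) x y : c \in l -> aa c -> ~~ bad c ->
  x \in N (vname c) -> y \in N (vname c) -> x != y -> x \in S -> y \in S ->
    False.
Proof.
move=> cl ca cb xc yc xy xS yS; have rl := oracle_run_run r.
have [h2 [sub cP nP nc]] := oracle_accept r cl ca cb.
have s3 := aa_size rl cl ca.
have [z Hz] : exists z, {in N (vname c), forall w, [|| w == x, w == y | w ==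
  z]}.
  by apply: third_mem; rewrite ?uniq_nbr ?s3.
have oS2 : optimal_extension h2 S by case: oS => mv H; split=> // p /sub/H.
have cS : vname c \in S by rewrite (opt_agree oS cl); case/andP: ca.
have [zc|zc] := boolP (z \in N (vname c)); last first.
  apply: (mvc_drop oS.1 cS) => w wc; case/or3P: (Hz w wc) => /eqP E;
    subst w => //.
  by rewrite wc in zc.
have mv : minimum_vertex_cover G (z |` (S `\ vname c)).
  apply: mvc_swap => //; [exact: oS.1|exact: nbrV zc|] => w wc.
  by case/or3P: (Hz w wc) => /eqP E; subst w; rewrite ?xS ?yS ?eqxx ?orbT.
apply: nc; apply: (correctP (swap_agree oS2 cP (nP z zc) mv)).
rewrite in_fsetU in_fset1 in_fsetD1 eqxx orbF.
by apply/eqP => E; move: zc; rewrite -E nbrxx.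
Qed.

Variable v : nat.
Hypotheses (vV : v \in V) (vP : v \notin processed l).

(** As [b] was bad, [e] was next to a contributing vertex [c]. If [v] were in the cover, the
    neighbors of [e] would be [v], [b] and [c], with only [b] outside; exchanging [e] for [b] would
    make it correct to accept [b], contrary to the advice. *)
Lemma class4_out (e : entry) : e \in l -> vname e \in N v ->
  meets_rejected_bad l e ->
  v \notin S.
Proof.
move=> el ev /hasP[b bl /and3P[bb ba eb]]; apply/negP => vS.
have rl := oracle_run_run r; rewrite (nbhE rl bl) in eb.
have [h2 [sub sub' bP cn nc]] := oracle_reject r bl bb ba.
have /andP[eP /hasP[c cl /andP[/and3P[/andP[_ ca] _ _] ec]]] := cn _ eb.
have {}cl := sub' _ cl; rewrite (nbhE rl cl) in ec.
have bS : vname b \notin S by rewrite (opt_agree oS bl).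
have cS : vname c \in S by rewrite (opt_agree oS cl).
have eS : vname e \in S by apply: opt_cover bS.
have eV := nbrV ev.
have vb : v != vname b by apply/eqP => E; rewrite -E vS in bS.
have be : vname b \in N (vname e) by rewrite nbrC.
have ve : v \in N (vname e) by rewrite nbrC.
have ce : vname c \in N (vname e) by rewrite nbrC.
have [z Hz] := third_mem (uniq_nbr _) (size_nbr eV) ve be vb.
have zc : z = vname c.
  case/or3P: (Hz _ ce) => /eqP // E.
    by move: vP; rewrite -E map_f.
  by rewrite -E cS in bS.
have mv : minimum_vertex_cover G (vname b |` (S `\ vname e)).
  apply: mvc_swap => //; [exact: oS.1|exact: nbrV be|] => w we.
  by case/or3P: (Hz w we) => /eqP->; rewrite ?zc ?vS ?cS ?eqxx ?orbT.
have oS2 : optimal_extension h2 S by case: oS => m H; split=> // p /sub/H.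
apply: nc; apply: (correctP (swap_agree oS2 eP bP mv)).
by rewrite in_fsetU in_fset1 eqxx.
Qed.

Lemma class5_out : ~~ forced l v -> 2 <= deg l v -> a_sibling l (vitem G v) ->
  v \notin S.
Proof.
move=> nf d2 /hasP[e el /and3P[ea ve /hasP[u ue /andP[uv uA]]]];
  apply/negP => vS.
have rl := oracle_run_run r; rewrite (nbhE rl el) in ue.
have ve' : v \in N (vname e) by rewrite nbrC.
have nb : ~~ bad e.
  by apply/negP => be; have := bad_nbr rl el be ve' vP; rewrite leqNgt d2.
apply: (aa_two_in el ea nb ue ve' uv) => //.
by case/mapP: uA => e0; rewrite mem_filter => /andP[ae e0l] ->;
  rewrite (opt_agree oS e0l).
Qed.

Lemma class6_in : has (fun e => [&& aa e, ~~ bad e & 2 <= common (vitem G v)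
  e]) l ->
  v \in S.
Proof.
case/hasP=> e el /and3P[ea eb]; have rl := oracle_run_run r.
rewrite /common (nbhE rl el) /= => c2; apply/negPn/negP => vS.
have : 2 <= count predT (N v `&` N (vname e)) by rewrite count_predT.
case/(count2P (fset_uniq _)) => x [y [xy]].
rewrite !in_fsetI => /andP[xv xe] /andP[yv ye] _ _.
by apply: (aa_two_in el ea eb xe ye xy); apply: opt_cover vS.
Qed.

Hypothesis nf : ~~ forced l v.

Lemma class2_out : deg l v = 0 -> v \notin S.
Proof.
move=> d0; apply/negP => vS; apply: (mvc_drop oS.1 vS) => w wv.
apply: (processed_accepted nf wv); apply/negPn/negP => wP.
have : 0 < deg l v by rewrite /deg -has_count; apply/hasP; exists w => //=.
by rewrite d0.
Qed.

(** The vertex can be exchanged for its only unprocessed neighbor, because all its other neighbors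
    were accepted. *)
Lemma class3_extension : deg l v = 1 ->
  exists S', optimal_extension h S' /\ v \notin S'.
Proof.
move=> d1; have [vS|vS] := boolP (v \in S); last by exists S.
have : 1 <= deg l v by rewrite d1.
case/count1P => w wv /= wP; exists (w |` (S `\ v)); split; last first.
  rewrite in_fsetU in_fset1 in_fsetD1 eqxx orbF.
  by apply/eqP => E; move: wv; rewrite -E nbrxx.
apply: swap_agree => //; apply: mvc_swap => //; [exact: oS.1|exact: nbrV wv|].
move=> z zv; case: eqVneq => //= zw; apply: (processed_accepted nf zv).
apply/negPn/negP => zP; have := two_unprocessed zv wv zw zP wP.
by rewrite d1.
Qed.

End Extension.

Section Cycles.

Variables (h : history) (v : nat).
Local Notation l := (log_of h).
Hypotheses (r : oracle_run G h) (vV : v \in V) (vP : v \notin processed l).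
Hypothesis deg2 : forall u, u \in V -> u \notin processed l -> deg l u = 2.
Hypothesis nf : forall u, u \in V -> u \notin processed l -> ~~ forced l u.

(* The unprocessed vertices around which every optimal extension alternates. *)
Definition alternating a := [/\ a \in V, a \notin processed l &
  forall S b, optimal_extension h S -> b \in N a -> b \notin processed l ->
    a \in S -> b \in S -> False].

Hypothesis allv : forall S, optimal_extension h S -> v \in S.

Lemma swap_extension S a b c : optimal_extension h S -> a \in S ->
  a \in V -> a \notin processed l ->
  b \in S -> c \in N a -> c \notin processed l ->
  {in N a, forall y, y \notin processed l -> (y == b) || (y == c)} ->
  optimal_extension h (c |` (S `\ a)).
Proof.
move=> oS aS aV aP bS ca cP Hab; apply: swap_agree => //.
apply: mvc_swap => //; [exact: oS.1|exact: nbrV ca|] => w wa.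
have [wP|wP] := boolP (w \in processed l).
  by rewrite (processed_accepted oS (nf aV aP) wa wP) orbT.
by have /orP[/eqP->|->] := Hab w wa wP; rewrite ?bS ?orbT.
Qed.

(** If [v] and a neighbor [b] were both in the cover, exchanging [v] for its other neighbor would
    give an optimal extension without [v]. *)
Lemma alternating_v : alternating v.
Proof.
split=> // S b oS bv bP vS bS.
have [b' [b'v b'b b'P Hb]] := other_nbr (deg2 vV vP) bv bP.
have /allv := swap_extension oS vS vV vP bS b'v b'P Hb.
rewrite in_fsetU in_fset1 in_fsetD1 eqxx orbF => /eqP E.
by move: b'v; rewrite -E nbrxx.
Qed.

(** Suppose [a] and its neighbor [b] are both in the cover. Then [c] is not, so its other neighbor
    [d] is. Exchanging [a] for [c] yields an optimal extension that contains both [c] and [d],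
    contrary to the alternation at [c]. *)
Lemma alternating_nbr c a : alternating c -> a \in N c ->
  a \notin processed l ->
  alternating a.
Proof.
move=> [cV cP altc] ac aP; have aV := nbrV ac; split=> // S b oS ba bP aS bS.
have ca : c \in N a by rewrite nbrC.
have [d [dc da dP Hd]] := other_nbr (deg2 cV cP) ac aP.
have cS : c \notin S by apply/negP => cS; apply: (altc S a oS).
have bc : b != c by apply/eqP => E; rewrite -E bS in cS.
have Hab : {in N a, forall y, y \notin processed l -> (y == b) || (y == c)}.
  have [y [ya yc yP Hy]] := other_nbr (deg2 aV aP) ca cP.
  have /orP[E|/eqP E] := Hy b ba bP; first by rewrite E in bc.
  by move=> z za zP; rewrite orbC E; exact: Hy.
have oS' := swap_extension oS aS aV aP bS ca cP Hab.
have dS : d \in S by apply: (opt_cover oS dc).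
apply: (altc _ d oS' dc dP); first by rewrite in_fsetU in_fset1 eqxx.
by rewrite in_fsetU in_fsetD1 da dS orbT.
Qed.

(* Flipping an optimal extension on the alternating vertices preserves its size,
   by counting the edges between the two sides, and removes [v]. *)
Lemma no_common_vertex : ~ extendable G h.
Proof.
case=> S oS; have {}oS : optimal_extension h S by [].
pose A := [fset u in S | `[< alternating u >]].
pose B := [fset u in V | (u \notin S) && `[< alternating u >]].
have altP u : reflect (alternating u) `[< alternating u >] by exact: asboolP.
have SV := oS.1.1.1.
have AE u : (u \in A) = (u \in S) && `[< alternating u >] by rewrite !inE.
have BE u : (u \in B) = (u \notin S) && `[< alternating u >].
  rewrite !inE /=; case: (altP u) => [[uV _ _]|]; last by rewrite !andbF.
  by rewrite uV.
have nbrA a : a \in A -> count [pred w | w \in B] (N a) = 2.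
  rewrite AE => /andP[aS /altP alta]; have [aV aP Ha] := alta.
  rewrite -(deg2 aV aP); apply: eq_in_count => w wa; rewrite /= BE.
  apply/andP/idP => [[_ /altP[_ //]]|wP]; split.
    by apply/negP => wS; apply: (Ha S w).
  by apply/altP; apply: (alternating_nbr alta).
have nbrB b : b \in B -> count [pred w | w \in A] (N b) = 2.
  rewrite BE => /andP[bS /altP altb]; have [bV bP Hb] := altb.
  rewrite -(deg2 bV bP); apply: eq_in_count => w wb; rewrite /= AE.
  apply/andP/idP => [[_ /altP[_ //]]|wP]; split.
    by apply: (opt_cover oS wb).
  by apply/altP; apply: (alternating_nbr altb).
have sum2 (X Y : {fset nat}) : (forall a, a \in X -> count [pred w | w \in Y]
  (N a) = 2) ->
    \sum_(a <- X) \sum_(b <- Y) (b \in N a) = 2 * #|` X|.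
  move=> H; rewrite (eq_big_seq (fun=> 2)) => [|a aX].
    by rewrite big_const_seq iter_addn_0 count_predT.
  rewrite -(H a aX) -(count_mem_sym (uniq_nbr a) (fset_uniq Y)) -sum1_count.
  by rewrite [RHS]big_mkcond; apply: eq_bigr => b _ /=; case: (b \in N a).
have AB : #|` A| = #|` B|.
  have := sum2 A B nbrA; have := sum2 B A nbrB; rewrite exchange_big /=.
  have -> : \sum_(j <- A) \sum_(i <- B) (j \in N i) = \sum_(a <- A) \sum_(b <-
    B) (b \in N a).
    by apply: eq_bigr => a _; apply: eq_bigr => b _; rewrite nbrC.
  by move=> ->; clear; lia.
pose S' := (S `\` A) `|` B.
have S'E u : (u \in S') = (u \in S) (+) `[< alternating u >].
  rewrite in_fsetU in_fsetD AE BE; case: (u \in S); case: `[< _ >] => //.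
have cov : vertex_cover G S'.
  split.
    rewrite fsubUset (fsubset_trans (fsubsetDl _ _) SV) /=.
    by apply/fsubsetP => u; rewrite !inE /= => /andP[].
  (* A neighbor of an alternating vertex is either alternating itself, and the two swap sides, or
     processed, hence accepted and untouched by the flip. *)
  have half u w : adj G u w -> alternating u -> (u \in S') || (w \in S').
    move=> uw altu; have wu : w \in N u by rewrite nbrE.
    have [uV uP Hu] := altu; have /altP au := altu.
    rewrite !S'E au addbT; case uS : (u \in S) => //=.
    have [wP|wP] := boolP (w \in processed l).
      have -> : `[< alternating w >] = false by apply/altP => -[_]; rewrite wP.
      by rewrite (processed_accepted oS (nf uV uP) wu wP).
    have /altP-> := alternating_nbr altu wu wP.
    by rewrite addbT; apply/negP => wS; apply: (Hu S w).
  move=> u w uw.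
  have [au|nau] := altP u; first exact: half.
  have [aw|naw] := altP w; first by rewrite orbC; apply: half => //;
    rewrite adj_sym.
  rewrite !S'E; have /altP/negPf-> := nau; have /altP/negPf-> := naw.
  by rewrite !addbF; apply: oS.1.1.2.
have S'le : #|` S'| <= #|` S|.
  apply: leq_trans (leq_card_fsetU _ _) _.
  rewrite -AB cardfsDS; last by apply/fsubsetP => u; rewrite AE => /andP[].
  rewrite subnK //; apply: fsubset_leq_card.
  by apply/fsubsetP => u; rewrite AE => /andP[].
have oS' : optimal_extension h S'.
  split; first by split=> // T /oS.1.2; apply: leq_trans.
  move=> p ph; rewrite S'E -(oS.2 p ph).
  have pP : p.1.1 \in processed l by rewrite processed_log_of;
    apply: (map_f (fun q : item * bool => q.1.1)).
  have -> : `[< alternating p.1.1 >] = false by apply/altP => -[_]; rewrite pP.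
  by rewrite addbF.
have := allv oS'; rewrite S'E (allv oS).
by have /altP-> := alternating_v.
Qed.

End Cycles.

Lemma oracle_run_extendable h : oracle_run G h -> extendable G h.
Proof.
elim=> [|{}h v a r [S oS] vV vP tv acc orc].
  by have [S mS] := mvc_exists; exists S.
have {}oS : optimal_extension h S by [].
(* The membership of [v] in [S] is a correct decision. If the opposite is correct too, either bit
   will do; otherwise the oracle must give this one. *)
have [rq|nrq] := boolP (requests_advice (log_of h) (vitem G v)).
  have [or1 or2] := orc rq.
  have cd := correctP oS (erefl : (v \in S) = _).
  have [nc|c] := EM (correct G h (vitem G v) (~~ (v \in S))).
    by case: (a) cd nc; case: (v \in S).
  by rewrite (or1 _ cd c).
have {}acc := acc nrq.
suff [S' [oS' vS']] : exists S', optimal_extension h S' /\ (v \in S') = a.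
  exact: (correctP oS' vS').
move: nrq (tv); rewrite {}acc /requests_advice /top.
case: (vclassP (log_of h) vV) => //.
- move=> /forcedP[e el /andP[ev ae]] _ _; exists S; split=> //=.
  apply: (opt_cover oS (u := vname e)); first by rewrite nbrC.
  by rewrite (opt_agree oS el).
- by move=> nf d _ _; exists S; split=> //; apply/negbTE/(class2_out oS).
- move=> nf d _ _; have [S' [oS' vS']] := class3_extension oS vP nf d.
  by exists S'; split=> //; apply/negbTE.
- move=> nf d /hasP[e el /andP[ev me]] _ _; exists S; split=> //.
  by apply/negbTE; apply: (class4_out r oS vP el ev me).
- by move=> nf d as_ _ _; exists S; split=> //; apply/negbTE;
    apply: (class5_out r oS).
- by move=> nf d H _ _; exists S; split=> //; apply: (class6_in r oS H).
move=> nf d _ tv9.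
(* P9 is the lowest class, so every unprocessed vertex is in it. *)
have class9 u : u \in V -> u \notin processed (log_of h) ->
    deg (log_of h) u = 2 /\ ~~ forced (log_of h) u.
  by move=> uV uP; have := tv9 u uV uP; case: (vclassP (log_of h) uV).
have [//|none] := EM (exists S', optimal_extension h S' /\ (v \in S') = false).
case: (@no_common_vertex h v vV vP); last by exists S.
- by move=> u uV uP; have [] := class9 u uV uP.
- by move=> u uV uP; have [] := class9 u uV uP.
move=> S' oS'; apply/negPn/negP => vS'; apply: none; exists S'.
by split=> //; apply/negbTE.
Qed.

End Graph.

(** * Executions *)

Lemma has_max_nat (T : eqType) (f : T -> nat) (s : seq T) : s != [::] ->
  exists2 y, y \in s & {in s, forall z, f z <= f y}.
Proof.
elim: s => // x s IH _; case: (eqVneq s [::]) => [->|/IH[y ys Hy]].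
  by exists x; rewrite ?mem_head // => z; rewrite mem_seq1 => /eqP->.
case: (leqP (f x) (f y)) => xy.
  by exists y; rewrite ?in_cons ?ys ?orbT // => z; rewrite in_cons =>
    /orP[/eqP->|/Hy].
exists x; rewrite ?mem_head // => z; rewrite in_cons => /orP[/eqP->//|/Hy zy].
exact: leq_trans zy (ltnW xy).
Qed.

Section Rank.

Variable l : log.

Lemma vclass_le10 x : vclass l x <= 10.
Proof. by rewrite /vclass; do !case: ifP. Qed.

Lemma recency_le x : recency l x <= size l.
Proof. by rewrite /recency /last_time; do !case: ifP => _ //;
  exact: leq_subr. Qed.

Lemma rank_vclass x y : rank l x <= rank l y -> vclass l y <= vclass l x.
Proof.
rewrite /rank => H; rewrite leqNgt; apply/negP => c.
have := recency_le y; have := vclass_le10 y.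
have : 10 - vclass l x = (10 - vclass l y) + (vclass l y - vclass l x).
  by have := vclass_le10 y; move: c; clear; lia.
move: H c; move: (recency l x) (recency l y) (two_aa l x : nat) (vclass l x)
  (vclass l y).
have : two_aa l y <= 1 by case: (two_aa l y).
move: (two_aa l y : nat) (size l) => t s t1 rx ry tx cx cy.
set K := s.+1 * 2 => H c E c10 rs; rewrite E mulnDl in H.
have : K <= (cy - cx) * K by rewrite leq_pmull // subn_gt0.
move: H; move: ((cy - cx) * K) ((10 - cy) * K) => p q; rewrite /K.
by move: t1 rs; clear; lia.
Qed.

End Rank.

(** * The rank ignores the names not seen yet *)

Section Anonymous.

Variables (h : history) (x y : item).
Hypothesis eq_xy : anonymize (names_in (items_of h)) x = anonymize (names_in
  (items_of h)) y.

Local Notation l := (log_of h).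
Local Notation S := (names_in (items_of h)).

Lemma log_of_names (e : entry) : e \in l -> vname e \in S /\ {subset nbh e <=
  S}.
Proof.
move=> /log_of_mem eh; have ih : it e \in items_of h.
  exact: (map_f (fun p : item * bool => p.1) eh).
split=> [|u ue]; rewrite in_fset; apply/flattenP.
  exists (vname e :: enum_fset (nbh e)); last exact: mem_head.
  exact: (map_f (fun z : item => z.1 :: enum_fset z.2) ih).
exists (vname e :: enum_fset (nbh e)); last by rewrite in_cons ue orbT.
exact: (map_f (fun z : item => z.1 :: enum_fset z.2) ih).
Qed.

Lemma anon_nbr u : u \in S -> (u \in x.2) = (u \in y.2).
Proof.
case: eq_xy => _ /fsetP/(_ u) + _ uS; by rewrite !in_fsetI uS !andbT.
Qed.

Lemma anon_name u : u \in S -> (u == x.1) = (u == y.1).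
Proof.
case: eq_xy => + _ _ uS; case: (boolP (x.1 \in S)) => xS;
  case: (boolP (y.1 \in S)) => yS //.
  by case=> ->.
move=> _; case: eqVneq => [E|_]; first by rewrite -E uS in xS.
by case: eqVneq => [E|_] //; rewrite -E uS in yS.
Qed.

Lemma anon_processed u : u \in processed l -> u \in S.
Proof. by case/mapP=> e el ->; case: (log_of_names el). Qed.

(** All processed neighbors are visible names, and the size of the whole neighborhood is visible; so
    the number of the remaining neighbors is determined. *)
Lemma anon_degree : current_degree l x = current_degree l y.
Proof.
rewrite /current_degree /current_neighborhood !card_fset_sep.
have E : count [pred u | u \in processed l] x.2 = count [pred u | u \in
  processed l] y.2.
  rewrite -!card_fset_sep; congr #|` _|; apply/fsetP => u; rewrite !inE /=.
  case: (boolP (u \in processed l)) => uP; last by rewrite !andbF.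
  by rewrite !andbT anon_nbr // anon_processed.
have : size x.2 = size y.2 by case: eq_xy.
rewrite -(count_predC [pred u | u \in processed l] x.2).
by rewrite -(count_predC [pred u | u \in processed l] y.2) E => /addnI.
Qed.

Lemma anon_processed_neighbor (e : entry) : e \in l ->
  processed_neighbor x e = processed_neighbor y e.
Proof. by move=> /log_of_names[eS _]; exact: anon_nbr. Qed.

Lemma anon_common (e : entry) : e \in l -> common x e = common y e.
Proof.
move=> /log_of_names[_ eS]; congr #|` _|; apply/fsetP => u; rewrite !in_fsetI.
case: (boolP (u \in nbh e)) => ue; last by rewrite !andbF.
by rewrite !andbT anon_nbr // eS.
Qed.

Lemma anon_a_sibling : a_sibling l x = a_sibling l y.
Proof.
apply: eq_in_has => e el; rewrite anon_processed_neighbor //.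
congr [&& _, _ & _]; apply: eq_in_has => u ue.
by rewrite anon_name //; case: (log_of_names el) => _; apply.
Qed.

Lemma anon_vclass : vclass l x = vclass l y.
Proof.
rewrite /vclass anon_degree anon_a_sibling.
have -> : has (rejected_neighbor x) l = has (rejected_neighbor y) l.
  by apply: eq_in_has => e el; rewrite /rejected_neighbor
    anon_processed_neighbor.
have -> : has (fun e => processed_neighbor x e && meets_rejected_bad l e) l
        = has (fun e => processed_neighbor y e && meets_rejected_bad l e) l.
  by apply: eq_in_has => e el; rewrite anon_processed_neighbor.
have -> : has (fun e => [&& aa e, ~~ bad e & 2 <= common x e]) l
        = has (fun e => [&& aa e, ~~ bad e & 2 <= common y e]) l.
  by apply: eq_in_has => e el; rewrite anon_common.
have -> // : has (fun e => ad e && (1 <= common x e)) l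
           = has (fun e => ad e && (1 <= common y e)) l.
by apply: eq_in_has => e el; rewrite anon_common.
Qed.

Lemma anon_rank : rank l x = rank l y.
Proof.
rewrite /rank /recency /two_aa !anon_vclass.
rewrite /last_time (@eq_in_find _ (rejected_neighbor x) (rejected_neighbor y));
  last first.
  by move=> e el; rewrite /rejected_neighbor anon_processed_neighbor.
rewrite (@eq_in_find _ (processed_neighbor x) (processed_neighbor y));
  last first.
  exact: anon_processed_neighbor.
have -> // : count (fun e => processed_neighbor x e && aa e) l
           = count (fun e => processed_neighbor y e && aa e) l.
by apply: eq_in_count => e el; rewrite anon_processed_neighbor.
Qed.

End Anonymous.

(** * Dependence of a run on the advice tape *)

Section Replay.

Variables (R : realType) (A : algorithm R).

Lemma consult_le D (r : reading D) t k : k <= (consult r t k).2.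
Proof. by elim: r k => [d|f IH] k //=; apply: leq_trans (leqnSn k) (IH _ _).
  Qed.

Lemma consult_agree D (r : reading D) t t' k :
  (forall j, j < (consult r t k).2 -> t' j = t j) -> consult r t' k = consult r
    t k.
Proof.
elim: r k => [d|f IH] k //= H.
have -> : t' k = t k by apply: H; apply: consult_le.
exact: IH.
Qed.

Lemma replay_le t x xs : (replay A t xs).2 <= (replay A t (x :: xs)).2.
Proof.
rewrite /=; case: (replay A t xs) => h k.
case E: consult => [d k'] /=.
by have := consult_le (decision A h (mkseq t k) x) t k; rewrite E.
Qed.

(** A run depends only on the bits it has read. Hence the oracle can write the tape bit by bit, and
    a finite prefix can stand for the tape. *)
Lemma replay_agree t t' xs :
  (forall j, j < (replay A t xs).2 -> t' j = t j) -> replay A t' xs = replay A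
    t xs.
Proof.
elim: xs => [|x xs IH] H; first by rewrite /= (consult_agree H).
have H' j : j < (replay A t xs).2 -> t' j = t j.
  by move=> jk; apply: H; apply: leq_trans jk (replay_le t x xs).
have E := IH H'; move: H H'; rewrite /= E; case: (replay A t xs) => h k /= H H'.
have -> : mkseq t' k = mkseq t k.
  by apply/eq_in_map => j; rewrite mem_iota add0n => /H'.
rewrite (@consult_agree _ _ t) // => j jk; apply: H.
by move: jk; case: consult.
Qed.

Lemma items_of_replay t xs : items_of (replay A t xs).1 = xs.
Proof.
elim: xs => //= x xs IH; case: (replay A t xs) IH => h k /= IH.
by case: consult => d k' /=; rewrite /items_of /= -/(items_of h) IH.
Qed.

Variable tb : tie_breaker.
Variable X : seq item.

Lemma received_agree t t' i :
  (forall j, j < (replay A t (received A tb t X i)).2 -> t' j = t j) ->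
  received A tb t' X i = received A tb t X i.
Proof.
elim: i => [//|i IH] H.
have H' j : j < (replay A t (received A tb t X i)).2 -> t' j = t j.
  by move=> jk; apply: H; apply: leq_trans jk (replay_le _ _ _).
rewrite /= (IH H') /next_item (replay_agree H').
case E: (replay A t _) => [h k]; rewrite E in H'.
have -> // : mkseq t' k = mkseq t k.
by apply/eq_in_map => j; rewrite mem_iota add0n => /H'.
Qed.

Lemma replay_received_le t i j : i <= j ->
  (replay A t (received A tb t X i)).2 <= (replay A t (received A tb t X j)).2.
Proof.
elim: j => [|j IH]; first by rewrite leqn0 => /eqP->.
rewrite leq_eqVlt => /orP[/eqP->//|/IH H]; apply: leq_trans H _.
exact: replay_le.
Qed.

Lemma remaining_mem xs : uniq X ->
  uniq (remaining X xs) /\ forall y, (y \in remaining X xs) = (y \in X) && (y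
    \notin xs).
Proof.
move=> uX; elim: xs => [|x xs [IHu IH]] /=; first by split=> // y;
  rewrite andbT.
split; first exact: rem_uniq.
by move=> y; rewrite mem_rem_uniq // inE IH in_cons negb_or;
  case: (y == x) => //=; rewrite andbF.
Qed.

End Replay.

Lemma top_items_nonempty (R : realType) h a (s : seq item) : s != [::] ->
  top_items (PriorityVC R) h a s != [::].
Proof.
move=> /(has_max_nat (rank (log_of h)))[y ys Hy].
have : y \in top_items (PriorityVC R) h a s.
  rewrite mem_filter ys andbT; apply/allP => z zs /=.
  by rewrite Num.Theory.ler_nat Hy.
by case: (top_items _ _ _ _).
Qed.

Section Simulation.

Variables (R : realType) (G : graph) (tb : tie_breaker).
Hypotheses (deg3 : max_degree_le 3 G) (vtb : valid_tie_breaker tb).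

Local Notation A := (PriorityVC R).
Local Notation X := (input G).
Local Notation V := (vertices G).

Definition oracle_at (t : nat -> bool) i :=
    let xs := received A tb t X i in
    let x := next_item A tb t X xs in
    let: (h, k) := replay A t xs in
    requests_advice (log_of h) x -> oracle_advice G h x (t k).

Lemma input_uniq : uniq X.
Proof. by rewrite map_inj_uniq ?fset_uniq // => u v []. Qed.

Lemma mem_input x : x \in X -> exists2 v, v \in V & x = vitem G v.
Proof. by case/mapP=> v vV ->; exists v. Qed.

(** Links executions to the abstract runs; the equation for [k] identifies the tape position with
    the number of requests in the log. *)
Lemma simulation t i : i <= size X -> (forall j, j < i -> oracle_at t j) ->
  let xs := received A tb t X i in
  let: (h, k) := replay A t xs in
  [/\ oracle_run G h, uniq xs, {subset xs <= X}, size xs = i & k = bits (log_of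
    h)].
Proof.
elim: i => [|i IH] iX orc /=; first by split=> //; constructor.
have {IH} := IH (ltnW iX) (fun j ji => orc j (ltnW ji)).
have := orc i (ltnSn i); rewrite /oracle_at /=.
set xs := received A tb t X i; set x := next_item A tb t X xs.
have : x = next_item A tb t X xs by []; rewrite /next_item.
have := items_of_replay A t xs.
case: (replay A t xs) => h k /= hxs xE orc_x [r uxs sub sxs kE].
have [_ memr] := remaining_mem xs input_uniq.
have r0 : remaining X xs != [::].
  apply/negP => /eqP E.
  have : {subset X <= xs}.
    by move=> y yX; have := memr y; rewrite E in_nil yX /= => /esym/negbFE.
  by move=> /(uniq_leq_size input_uniq); rewrite sxs leqNgt iX.
have : x \in top_items A h (mkseq t k) (remaining X xs).
  by rewrite xE; apply: vtb; apply: top_items_nonempty.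
rewrite mem_filter memr => /and3P[/allP xtop xX xxs].
have [v vV xv] := mem_input xX.
have Ph u : u \in V -> (u \in processed (log_of h)) = (vitem G u \in xs).
  move=> uV; rewrite processed_log_of -hxs /items_of;
    apply/mapP/mapP => -[p ph E].
    exists p => //; have /sub/mem_input[w _ pw] : p.1 \in xs.
      by rewrite -hxs; apply: (map_f (fun p : item * bool => p.1)).
    by rewrite pw E pw.
  by exists p; rewrite // -E.
have vP : v \notin processed (log_of h) by rewrite Ph // -xv.
have tv : top G (log_of h) v.
  move=> u uV; rewrite Ph // => unx; apply: rank_vclass; rewrite -xv.
  have := xtop (vitem G u); rewrite memr unx andbT (map_f (vitem G) uV) /=.
  by rewrite Num.Theory.ler_nat; apply.
rewrite xv in orc_x *.
case E: (requests_advice (log_of h) (vitem G v)); rewrite /= ?E.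
  split.
  - by apply: oracle_run_cons => //; rewrite E.
  - by rewrite -xv xxs.
  - by move=> y; rewrite in_cons -xv => /orP[/eqP->|/sub].
  - by rewrite sxs.
  - by rewrite kE.
split.
- by apply: oracle_run_cons => //; rewrite E.
- by rewrite -xv xxs.
- by move=> y; rewrite in_cons -xv => /orP[/eqP->|/sub].
- by rewrite sxs.
- by rewrite kE.
Qed.

Lemma oracle_advice_exists h x : exists b, oracle_advice G h x b.
Proof.
have [ct|nct] := EM (correct G h x true); have [cf|ncf] := EM (correct G h x
  false).
- by exists (bad_vertex (log_of h) x); split=> // -[_ /(_ cf)|_ /(_ ct)].
- by exists true; split=> // -[].
- by exists false; split=> // -[].
- by exists true; split=> // -[].
Qed.

(** The bit for iteration [n] is written at position [k], the number of bits read before it. Earlier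
    iterations read only smaller positions, so they remain unchanged. *)
Lemma oracle_tape_exists n : n <= size X ->
  exists t, forall i, i < n -> oracle_at t i.
Proof.
elim: n => [|n IH] nX; first by exists xpred0.
have [t Ht] := IH (ltnW nX).
have [h [k hk]] : exists h k, replay A t (received A tb t X n) = (h, k).
  by case: (replay _ _ _) => h k; exists h, k.
have [b Hb] := oracle_advice_exists h (next_item A tb t X (received A tb t X
  n)).
pose t' j := if j == k then b else t j.
have ag j : j < k -> t' j = t j by rewrite /t' ltn_neqAle => /andP[/negPf->].
have agi i : i <= n -> received A tb t' X i = received A tb t X i /\
    replay A t' (received A tb t' X i) = replay A t (received A tb t X i).
  move=> i_n; have H j : j < (replay A t (received A tb t X i)).2 -> t' j = t j.
    move=> jk; apply: ag; apply: leq_trans jk _.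
    by have := replay_received_le A tb X t i_n; rewrite hk.
  by rewrite (received_agree H) (replay_agree H).
have nexti i : i <= n -> next_item A tb t' X (received A tb t' X i)
                       = next_item A tb t X (received A tb t X i).
  move=> i_n; have [E1 E2] := agi i i_n; rewrite E1 /next_item.
  rewrite E1 in E2; rewrite E2; case E: (replay A t _) => [h' k'].
  have -> // : mkseq t' k' = mkseq t k'.
  apply/eq_in_map => j; rewrite mem_iota add0n => jk'; apply: ag.
  apply: leq_trans jk' _.
  by have := replay_received_le A tb X t i_n; rewrite hk E.
exists t' => i; rewrite ltnS leq_eqVlt => /orP[/eqP->|i_n]; rewrite /oracle_at.
  by rewrite nexti // (proj2 (agi n (leqnn n))) hk /t' eqxx.
have := Ht i i_n; rewrite /oracle_at nexti ?(ltnW i_n) //.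
rewrite (proj2 (agi i (ltnW i_n))); case E: (replay A t _) => [h' k'] H rq.
(* Iteration [i] requested advice, so the bit at [k'] had been read before iteration [n]. *)
have k'k : k' < k.
  have := replay_received_le A tb X t i_n; rewrite hk /= E /=.
  by rewrite rq.
by rewrite ag //; apply: H.
Qed.

End Simulation.

(** The function [Q] recovers the decisions by replaying the items on the advice read so far; on an
    actual run, the default bits [false] past its end are never consulted. *)
Lemma PriorityVC_oblivious (R : realType) : oblivious (PriorityVC R).
Proof.
exists (fun xs a x => ((rank (log_of (replay (PriorityVC R) (nth false a)
  xs).1) x)%:R)%R).
split.
  move=> t xs x; case E: (replay _ _ _) => [h k].
  have -> : replay (PriorityVC R) (nth false (mkseq t k)) xs = (h, k) => //.
  by rewrite -E; apply: replay_agree => j; rewrite E /= => jk;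
    rewrite nth_mkseq.
move=> xs a x y; rewrite -{1 2}(items_of_replay (PriorityVC R) (nth false a)
  xs).
by move=> /anon_rank->.
Qed.

Theorem theorem3 (R : realType) :
  decision_based (PriorityVC R) /\
  oblivious (PriorityVC R) /\
  (forall G : graph, triangle_free G -> max_degree_le 3 G ->
   forall tb : tie_breaker, valid_tie_breaker tb ->
     (exists t : nat -> bool, oracle_tape R G tb t) /\
     (forall t : nat -> bool, oracle_tape R G tb t ->
        minimum_vertex_cover G
          (accepted_vertices (PriorityVC R) tb t (input G)) /\
        ((advice_bits_used (PriorityVC R) tb t (input G))%:R
           <= (7%:R / 22%:R) * (#|` vertices G|)%:R :> R)%R)).
Proof.
split=> //; split; first exact: PriorityVC_oblivious.
move=> G tf deg3 tb vtb; split; first exact: (@oracle_tape_exists R G tb _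
  (leqnn _)).
move=> t ot; have := simulation vtb (leqnn (size (input G))) ot.
rewrite /accepted_vertices /advice_bits_used /execute.
have := items_of_replay (PriorityVC R) t
  (received (PriorityVC R) tb t (input G) (size (input G))).
case: (replay _ _ _) => h k /= hxs [r uxs sub sxs kE].
have allP : {subset vertices G <= processed (log_of h)}.
  move=> v vV; have [_ eq_xs] := uniq_min_size uxs sub (eq_leq (esym sxs)).
  have : vitem G v \in items_of h by rewrite hxs eq_xs (map_f (vitem G) vV).
  by rewrite processed_log_of => /mapP[p ph E]; apply/mapP; exists p;
    rewrite // -E.
split; last first.
  have := run_bits deg3 tf (oracle_run_run r) allP; rewrite -kE.
  by rewrite -(Num.Theory.ler_nat R) !GRing.natrM => H; lra.
have [S [mS HS]] := oracle_run_extendable deg3 r.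
have -> // : [fset v in [seq p.1.1 | p <- h & p.2]] = S.
apply/fsetP => v; rewrite in_fset; apply/mapP/idP => [[p]|vS].
  by rewrite mem_filter => /andP[p2 ph] ->; rewrite HS.
have := allP v (fsubsetP mS.1.1 v vS); rewrite processed_log_of => /mapP[p ph
  E].
by exists p; rewrite // mem_filter ph -HS // -E vS.
Qed.
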